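(* Assume that $\mathcal{X}$ is nonempty and define $\gamma_N=\frac1N+\left(1-\frac1N\right)\gamma$. Let $\{x^k\}_{k\ge0}$ be generated by algorithm SPA with stepsizes satisfying $\delta\le\alpha_k\le\frac{2}{\gamma_N}-\delta$ for all $k$, for some $0<\delta\le\frac1{\gamma_N}$. Then: (i) For the average point $\hat x^k=\frac{1}{\Sigma_k}\sum_{i=0}^{k-1}\alpha_ix^i$, where $\Sigma_k=\sum_{i=0}^{k-1}\alpha_i$ ($k\ge1$), $$\mathbf{E}[F(\hat x^k)]-F^*=\frac12\mathbf{E}[\mathrm{dist}^2_{\mathcal{X}_S}(\hat x^k)]\le\frac{\mathrm{dist}^2_{\mathcal{X}}(x^0)}{2\delta\gamma_N\Sigma_k}.$$ Moreover, the average sequence $\hat x^k$ converges almost surely to a random point in $\mathcal{X}$, provided that exactness holds, i.e. $\mathcal{X}=\{x\in\mathbb{R}^n:\mathbf{P}(x\in\mathcal{X}_S)=1\}$. (ii) If additionally the linear regularity property holds, i.e. there is $\kappa\in(0,\infty)$ with $\mathrm{dist}_{\mathcal{X}}^2(x)\le\kappa\,\mathbf{E}[\mathrm{dist}_{\mathcal{X}_S}^2(x)]$ for all $x\in\mathbb{R}^n$, then for all $k\ge0$ $$\mathbf{E}[\mathrm{dist}^2_{\mathcal{X}}(x^{k+1})]\le\left(1-\frac{\delta^2\gamma_N}{\kappa}\right)\mathbf{E}[\mathrm{dist}^2_{\mathcal{X}}(x^k)],$$ and in terms of function values $$\mathbf{E}[F(x^k)]-F^*\le\left(1-\frac{\d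elta^2\gamma_N}{\kappa}\right)^k\frac{\gamma\,\mathrm{dist}^2_{\mathcal{X}}(x^0)}{2}.$$
   Context: $\mathcal{X}\subseteq\mathbb{R}^n$ is a closed convex set and $(\Omega,\mathbf{P})$ is a probability space with random variable $S\sim\mathbf{P}$. For every $S\in\Omega$, $\mathcal{X}_S$ is a random closed convex subset of $\mathbb{R}^n$ with $\mathcal{X}\subseteq\mathcal{X}_S$; as part of ''random set'', the maps $(S,x)\mapsto\Pi_{\mathcal{X}_S}(x)$ are measurable. $\Pi_C$ is the Euclidean projection onto $C$ and $\mathrm{dist}_C$ the Euclidean distance to $C$. $F(x)=\frac12\mathbf{E}[\|x-\Pi_{\mathcal{X}_S}(x)\|^2]$, expectation over $S\sim\mathbf{P}$, and $F^*=\min_xF(x)=0$. In $\mathbf{E}[\mathrm{dist}^2_{\mathcal{X}_S}(\hat x^k)]$ the expectation is over both $\hat x^k$ and an independent $S\sim\mathbf{P}$. $\gamma\ge0$ is the smallest constant such that $\|\mathbf{E}[x-\Pi_{\mathcal{X}_S}(x)]\|^2\le\gamma\,\mathbf{E}[\|x-\Pi_{\mathcal{X}_S}(x)\|^2]$ for all $x\in\mathbb{R}^n$ (by Jensen, $\gamma\le1$). Algorithm SPA: choose (deterministic) $x^0\in\mathbb{R}^n$, minibatch size $N\ge1$ and positive stepsizes $\{\alpha_k\}_{k\ge0}$; for $k\ge0$, draw $N$ independent samples $S_1^k,\dots,S_N^k\sim\mathbf{P}$ (independent of the past) and set $x^{k+1}=x^k-\alpha_k\left(x^k-\frac1N\sum_{i=1}^N\Pi_{\mathcal{X}_{S_i^k}}(x^k)\right)$.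 *)

(* Defs.v *)
From HB Require Import structures.
From mathcomp Require Import all_boot all_order all_algebra.
From mathcomp Require Import all_classical all_reals all_analysis.

Set Implicit Arguments.
Unset Strict Implicit.
Unset Printing Implicit Defensive.

Import Order.TTheory GRing.Theory Num.Theory.
Import numFieldNormedType.Exports.

Local Open Scope classical_set_scope.
Local Open Scope ring_scope.

(* R^n with its Borel sigma-algebra, generated by the open sets of 'rV[R]_n. *)
Notation borel_rV R n := (g_sigma_algebraType (@open 'rV[R]_n)).

(* The library norm `|x| of 'rV[R]_n is the sup norm, whence this one. *)
Definition enorm (R : realType) (n : nat) (x : 'rV[R]_n) : R :=
  Num.sqrt (\sum_(j < n) x 0 j ^+ 2).

(* A nearest point of C to x, unique when C is nonempty, closed and convex;
   0 if there is no nearest point. *)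
Definition proj (R : realType) (n : nat) (C : set 'rV[R]_n) (x : 'rV[R]_n)
    : 'rV[R]_n :=
  xget 0 [set y | C y /\ forall z, C z -> enorm (x - y) <= enorm (x - z)].

Definition dist_set (R : realType) (n : nat) (C : set 'rV[R]_n) (x : 'rV[R]_n)
    : R :=
  inf [set enorm (x - y) | y in C].

(* XS s is the set attached to the outcome s; "random" means that the
   projection onto XS s is measurable jointly in (s, x). *)
Definition random_closed_convex_set (R : realType) (n : nat)
    (d : measure_display) (Om : measurableType d) (XS : Om -> set 'rV[R]_n) :=
  [/\ forall s, closed (XS s),
      forall s, convex_set (XS s : set (convex_lmodType 'rV[R]_n)) &
      measurable_fun [set: Om * borel_rV R n]
        (fun p => proj (XS p.1) p.2 : borel_rV R n)].

Section Objective.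
Context (R : realType) (n : nat) (d : measure_display) (Om : measurableType d).
Context (P : probability Om R) (XS : Om -> set 'rV[R]_n).

Definition residual (x : 'rV[R]_n) (s : Om) : 'rV[R]_n := x - proj (XS s) x.

Definition objective (x : 'rV[R]_n) : \bar R :=
  ((2^-1)%:E * 'E_P[fun s => (enorm (residual x s) ^+ 2)%R])%E.

Definition objective_min : \bar R := ereal_inf (range objective).

Definition mean_residual (x : 'rV[R]_n) : 'rV[R]_n :=
  \row_j fine ('E_P[fun s => (residual x s 0 j)%R])%E.

Definition gamma_bound (c : R) :=
  forall x, ((enorm (mean_residual x) ^+ 2)%:E <=
             c%:E * 'E_P[fun s => (enorm (residual x s) ^+ 2)%R])%E.

Definition is_gamma (c : R) :=
  [/\ 0 <= c, gamma_bound c & forall c', 0 <= c' -> gamma_bound c' -> c <= c'].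

Definition exactness (X : set 'rV[R]_n) :=
  X = [set x | P [set s | XS s x] = 1%E].

Definition linear_regularity (X : set 'rV[R]_n) (kappa : R) :=
  forall x, ((dist_set X x ^+ 2)%:E <=
             kappa%:E * 'E_P[fun s => (dist_set (XS s) x ^+ 2)%R])%E.

End Objective.

Definition mutually_independent (R : realType) (d d' : measure_display)
    (T : measurableType d) (T' : measurableType d') (Q : probability T R)
    (I : eqType) (Y : I -> {RV Q >-> T'}) :=
  forall (s : seq I) (A : I -> set T'),
    uniq s -> (forall i, measurable (A i)) ->
    Q (\bigcap_(i in [set` s]) (Y i @^-1` A i)) =
    (\prod_(i <- s) Q (Y i @^-1` A i))%E.

Definition iid_samples (R : realType) (d d' : measure_display)
    (Om : measurableType d) (P : probability Om R)
    (T : measurableType d') (Q : probability T R) (N : nat)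
    (S : nat -> 'I_N -> {RV Q >-> Om}) :=
  (forall k i (A : set Om), measurable A -> distribution Q (S k i) A = P A) /\
  mutually_independent (fun ki : nat * 'I_N => S ki.1 ki.2).

Definition spa_step (R : realType) (n : nat) (Om : Type) (N : nat)
    (XS : Om -> set 'rV[R]_n) (a : R) (s : 'I_N -> Om) (x : 'rV[R]_n)
    : 'rV[R]_n :=
  x - a *: (x - N%:R^-1 *: \sum_(i < N) proj (XS (s i)) x).

(* Main.v *)
From HB Require Import structures.
From mathcomp Require Import all_boot all_order all_algebra.
From mathcomp Require Import all_classical all_reals all_analysis measurable_realfun.
From mathcomp Require Import ring lra.
Require Import Defs.

Import Order.TTheory GRing.Theory Num.Theory.
Import numFieldNormedType.Exports.

Local Open Scope classical_set_scope.
Local Open Scope ring_scope.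

(** The residuals r_i = x - Pi_i x satisfy <r_i, x - y> >= |r_i|^2 for all y in X,
    so one step with stepsize a changes |x - y|^2 by at most
    - 2 a (mean of the |r_i|^2) + a^2 |mean of the r_i|^2.  Write phi(x) for
    E dist^2(x, X_S).  Given x, the first mean has expectation phi(x); in the second
    term the N diagonal products contribute phi(x) each and, by independence, the
    others |E r|^2 <= gamma phi(x), so its expectation is at most gamma_N phi(x).
    Taking y to be the projection of x onto X,
      E dist_X^2(x_{k+1}) <= E dist_X^2(x_k) - a_k (2 - a_k gamma_N) E phi(x_k).
    Summing this and using that phi is convex gives (i); linear regularity turns it
    into a contraction, and phi <= gamma dist_X^2 gives the bound on function values.
    For almost sure convergence, bound |mean of the r_i|^2 by the mean of the |r_i|^2:
    along almost every run the iterates are quasi-Fejer monotone with respect to X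
    with summable errors, while phi(x_k) tends to 0.  Exactness puts every cluster
    point in X, so the iterates converge, and so do their weighted averages. *)

(** Everything probabilistic rests on averaging out one fresh sample at a time. Independence is
    given only as product formulas for finitely many sample events, so an iteration is cut into N
    projections: each absorbs one sample into the history, and a Dynkin argument carries along
    independence from the remaining samples. Fubini on product laws then plays the role of
    conditional expectation. Integrability comes from a pathwise bound: for y in X a step multiplies
    a bound on |x_k - y|^2 by at most 1 + a_k^2, so at each fixed k all quantities are bounded
    uniformly over the runs. The stepsize window enters twice: a_k <= 2 / gamma_N - delta gives 2 -
    a_k gamma_N >= delta gamma_N, and a_k >= delta supplies the other factor delta of the rate and
    makes the sum of the E phi(x_k) finite. The bound by gamma holds only in mean, as it does not
    control the products <r_i, r_j> of a single run; hence the cruder bound in the almost sure part.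
    The batch mean of the |r_i|^2 and phi(x_k) have equal expectations, so monotone convergence
    makes both summable along almost every run. *)

(** * Inner product, and projection onto a closed convex set *)

Section EuclideanGeometry.
Context {R : realType} {n : nat}.
Implicit Types (x y z u v : 'rV[R]_n) (C : set 'rV[R]_n) (a t : R).

Definition dotv x y : R := \sum_j x 0 j * y 0 j.

Lemma dotvC x y : dotv x y = dotv y x.
Proof. by apply: eq_bigr => j _; rewrite mulrC. Qed.

Lemma dotvDl x y z : dotv (x + y) z = dotv x z + dotv y z.
Proof.
by rewrite /dotv -big_split; apply: eq_bigr => j _; rewrite mxE mulrDl.
Qed.

Lemma dotvZl a x y : dotv (a *: x) y = a * dotv x y.
Proof. by rewrite mulr_sumr; apply: eq_bigr => j _; rewrite mxE mulrA. Qed.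

Lemma dotvNl x y : dotv (- x) y = - dotv x y.
Proof. by rewrite -scaleN1r dotvZl mulN1r. Qed.

Lemma dotvBl x y z : dotv (x - y) z = dotv x z - dotv y z.
Proof. by rewrite dotvDl dotvNl. Qed.

Lemma dotvDr x y z : dotv z (x + y) = dotv z x + dotv z y.
Proof. by rewrite dotvC dotvDl !(dotvC z). Qed.

Lemma dotvZr a x y : dotv y (a *: x) = a * dotv y x.
Proof. by rewrite dotvC dotvZl (dotvC y). Qed.

Lemma dotvNr x y : dotv y (- x) = - dotv y x.
Proof. by rewrite dotvC dotvNl (dotvC y). Qed.

Lemma dotvBr x y z : dotv z (x - y) = dotv z x - dotv z y.
Proof. by rewrite dotvC dotvBl !(dotvC z). Qed.

Lemma dotv0l x : dotv 0 x = 0.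
Proof. by rewrite -[0](scale0r 0) dotvZl mul0r. Qed.

Lemma dotv_suml (I : Type) (r : seq I) (p : pred I) (F : I -> 'rV[R]_n) y :
  dotv (\sum_(i <- r | p i) F i) y = \sum_(i <- r | p i) dotv (F i) y.
Proof. exact: (big_morph (dotv^~ y) (fun u v => dotvDl u v y) (dotv0l y)). Qed.

Lemma dotv_sumr (I : Type) (r : seq I) (p : pred I) (F : I -> 'rV[R]_n) y :
  dotv y (\sum_(i <- r | p i) F i) = \sum_(i <- r | p i) dotv y (F i).
Proof. by rewrite dotvC dotv_suml; apply: eq_bigr => i _; rewrite dotvC. Qed.

Definition dotvE := (dotvDl, dotvDr, dotvNl, dotvNr, dotvZl, dotvZr).

Lemma dotv_ge0 x : 0 <= dotv x x.
Proof. by apply: sumr_ge0 => j _; rewrite -expr2 sqr_ge0. Qed.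

Lemma dotv_eq0 x : dotv x x = 0 -> x = 0.
Proof.
move=> x0; apply/rowP => j; rewrite mxE; apply/eqP.
have /eqP := x0; rewrite psumr_eq0 => [/allP/(_ j)|i _]; last first.
  by rewrite -expr2 sqr_ge0.
by rewrite mem_index_enum -expr2 sqrf_eq0 => /(_ isT).
Qed.

Lemma sqr_coord_le x j : x 0 j ^+ 2 <= dotv x x.
Proof.
rewrite /dotv (bigD1 j) //= expr2 lerDl.
by apply: sumr_ge0 => i _; rewrite -expr2 sqr_ge0.
Qed.

Lemma enorm_sqr x : enorm x ^+ 2 = dotv x x.
Proof.
rewrite sqr_sqrtr; first by apply: eq_bigr => j _; rewrite expr2.
by apply: sumr_ge0 => j _; rewrite sqr_ge0.
Qed.

Lemma enorm_ge0 x : 0 <= enorm x.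
Proof. exact: sqrtr_ge0. Qed.

Lemma ler_enorm x y : (enorm x <= enorm y) = (dotv x x <= dotv y y).
Proof. by rewrite -!enorm_sqr ler_pXn2r ?nnegrE ?enorm_ge0. Qed.

Lemma cauchy_schwarz x y : dotv x y ^+ 2 <= dotv x x * dotv y y.
Proof.
have [y0|y0] := eqVneq (dotv y y) 0.
  by rewrite (dotv_eq0 _ y0) dotvC !dotv0l mulr0 expr2 mulr0.
have yy : 0 < dotv y y by rewrite lt_neqAle eq_sym y0 dotv_ge0.
(* This square expands to <y, y> times the gap in the inequality. *)
have := dotv_ge0 (dotv y y *: x - dotv x y *: y).
rewrite !dotvE (dotvC y x) => h.
rewrite -subr_ge0 -(pmulr_rge0 _ yy); apply: le_trans h _.
by rewrite le_eqVlt; apply/orP; left; apply/eqP; ring.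
Qed.

Lemma dotv_young x y : dotv (x + y) (x + y) <= 2 * dotv x x + 2 * dotv y y.
Proof. have := dotv_ge0 (x - y); rewrite !dotvE (dotvC y x); lra. Qed.

(** The right side exceeds the left by exactly t (1 - t) |x - y|^2. *)
Lemma dotv_jensen t x y : 0 <= t <= 1 ->
  dotv (t *: x + (1 - t) *: y) (t *: x + (1 - t) *: y)
    <= t * dotv x x + (1 - t) * dotv y y.
Proof.
move=> /andP[t0 t1].
have := mulr_ge0 (mulr_ge0 t0 (_ : 0 <= 1 - t)) (dotv_ge0 (x - y)).
rewrite subr_ge0 => /(_ t1); rewrite !dotvE (dotvC y x) => h; nra.
Qed.

Lemma continuous_dotv_sub x : continuous (fun y : 'rV[R]_n => dotv (x - y) (x - y)).
Proof.
move=> y; rewrite /dotv; apply: (cvg_big add_continuous (nbhs_filter y)) => j _.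
have c : (fun y : 'rV[R]_n => (x - y) 0 j) y @[y --> y] --> (x - y) 0 j.
  rewrite !mxE (_ : (fun _ => _) = fun y : 'rV[R]_n => x 0 j - y 0 j); last first.
    by apply/funext => z; rewrite !mxE.
  exact: (@cvgB _ R^o _ _ (nbhs_filter y) (fun=> x 0 j) (fun z : 'rV_n => z 0 j) _ _
    (@cvg_cst _ _ _ (nbhs y) _) (@coord_continuous _ _ _ 0 j y)).
exact: (cvgM c c).
Qed.

(** The topology of ['rV[R]_n] is that of the sup norm; this comparison turns Euclidean estimates
    into boundedness and convergence there. *)
Lemma normr_le_enorm x : `|x| <= enorm x.
Proof.
have [->|x0] := eqVneq x 0; first by rewrite normr0 enorm_ge0.
have [|i] := @mx_norm_neq0 _ _ _ x; first by apply: contra_neq x0 => /mx_norm_eq0.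
rewrite -[mx_norm x]/(`|x|) => ->; rewrite (ord1 i.1).
by rewrite -(@ler_pXn2r _ 2) ?nnegrE ?enorm_ge0 // enorm_sqr real_normK ?num_real // sqr_coord_le.
Qed.

Lemma convex_set_conv C : convex_set (C : set (convex_lmodType 'rV[R]_n)) ->
  forall x y t, 0 <= t <= 1 -> C x -> C y -> C (t *: x + (1 - t) *: y).
Proof.
move=> cC x y t t01 Cx Cy.
have i01 : Itv.spec (@Itv.num_sem R) (Itv.Real `[0%Z, 1%Z]) t.
  by rewrite /= /Itv.num_sem num_real /= in_itv.
have := cC x y (Itv.Def i01); rewrite !inE /conv /=.
by apply.
Qed.

Section Projection.
Context (C : set 'rV[R]_n) (C_closed : closed C) (C0 : C !=set0).

(** Rules out the default value of [xget]: only points of C at least as close to x as some fixed y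
    in C compete, they form a compact set, and the squared distance attains its minimum on it. *)
Lemma proj_spec x :
  C (proj C x) /\ forall z, C z -> enorm (x - proj C x) <= enorm (x - z).
Proof.
case: C0 => y Cy; rewrite /proj; case: xgetP => [_ -> //|np]; exfalso.
pose K := C `&` [set z | dotv (x - z) (x - z) <= dotv (x - y) (x - y)].
have Kclosed : closed K.
  apply: closedI; first exact: C_closed.
  apply: (@closed_comp _ _ (fun z => dotv (x - z) (x - z))
    [set r | r <= dotv (x - y) (x - y)]); last exact: closed_le.
  by move=> z _; exact: continuous_dotv_sub.
have Kbnd : bounded_set K.
  exists (`|x| + enorm (x - y)); split; first exact: num_real.
  move=> M ltM z [_ /= zy]; apply/ltW; apply: le_lt_trans ltM.
  rewrite -[z](subKr x) (le_trans (ler_normB _ _)) // lerD2l.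
  by rewrite (le_trans (normr_le_enorm _)) // ler_enorm.
have [|c] := @EVT_min_rV R n (fun z => dotv (x - z) (x - z)) K _
   (bounded_closed_compact Kbnd Kclosed)
   (continuous_subspaceT (continuous_dotv_sub x)).
  by exists y; split=> /=.
rewrite inE => -[Cc cy] cmin; apply: (np c); split=> // z Cz.
rewrite ler_enorm; case: (leP (dotv (x - z) (x - z)) (dotv (x - y) (x - y))) => [zy|/ltW].
  by apply: cmin; rewrite inE.
exact: le_trans.
Qed.

Lemma proj_in x : C (proj C x).
Proof. by case: (proj_spec x). Qed.

Lemma dotv_proj_le x z : C z ->
  dotv (x - proj C x) (x - proj C x) <= dotv (x - z) (x - z).
Proof. by rewrite -ler_enorm; case: (proj_spec x) => _; apply. Qed.

Lemma proj_id x : C x -> proj C x = x.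
Proof.
move=> Cx; apply/eqP; rewrite eq_sym -subr_eq0; apply/eqP/dotv_eq0/eqP.
rewrite eq_le dotv_ge0 andbT; apply: le_trans (dotv_proj_le x x Cx) _.
by rewrite subrr dotv0l.
Qed.

Lemma dist_setE x : dist_set C x = enorm (x - proj C x).
Proof.
apply/eqP; rewrite eq_le; apply/andP; split.
  apply: ge_inf; last by exists (proj C x) => //; exact: proj_in.
  by exists 0 => _ [z _ <-]; exact: enorm_ge0.
apply: lb_le_inf; first by case: C0 => y Cy; exists (enorm (x - y)), y.
by move=> _ [z Cz <-]; case: (proj_spec x) => _; apply.
Qed.

Lemma dist_set_sqr x : dist_set C x ^+ 2 = dotv (x - proj C x) (x - proj C x).
Proof. by rewrite dist_setE enorm_sqr. Qed.

Lemma dist_set_sqr_le x z : C z -> dist_set C x ^+ 2 <= dotv (x - z) (x - z).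
Proof. by move=> Cz; rewrite dist_set_sqr dotv_proj_le. Qed.

Hypothesis C_convex : convex_set (C : set (convex_lmodType 'rV[R]_n)).

(* First-order optimality along the segment from the projection to z. *)
Lemma proj_obtuse x z : C z -> dotv (x - proj C x) (z - proj C x) <= 0.
Proof.
move=> Cz; set p := proj C x; rewrite leNgt; apply/negP => b0.
set b := dotv (x - p) (z - p) in b0; set q := dotv (z - p) (z - p).
have q0 : 0 <= q by exact: dotv_ge0.
(* Moving by t changes the squared distance by - t (2 b - t q). The summand b in the denominator
   keeps t at most 1, also when q = 0, and gives t q <= b. *)
pose t := b / (b + q).
have bq : 0 < b + q by rewrite ltr_wpDr.
have t0 : 0 < t by rewrite divr_gt0.
have t1 : t <= 1 by rewrite ler_pdivrMr // mul1r lerDl.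
have Ct : C (t *: z + (1 - t) *: p).
  by apply: convex_set_conv => //; rewrite ?(ltW t0) // /p; exact: proj_in.
have := dotv_proj_le x _ Ct; rewrite -/p.
have -> : x - (t *: z + (1 - t) *: p) = (x - p) - t *: (z - p).
  by rewrite scalerBl scale1r scalerBr; apply/rowP => j; rewrite !mxE; ring.
move: (x - p) (z - p) @b @q b0 q0 @t bq t0 t1 {Ct} => u v b q b0 q0 t bq t0 t1.
rewrite dotvBl !dotvBr !dotvZl !dotvZr (dotvC v u) -/b -/q => h.
have tE : t * (b + q) = b by rewrite divfK ?gt_eqF.
have : 0 < t * (2 * b - t * q).
  by apply: mulr_gt0 => //; nra.
lra.
Qed.

(** The obtuse angle at the projection p, with z - p written as (x - p) - (x - z). In this form
    convexity enters the estimate of a step. *)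
Lemma dotv_proj_le_dotv x z : C z ->
  dotv (x - proj C x) (x - proj C x) <= dotv (x - proj C x) (x - z).
Proof.
move=> Cz; have := proj_obtuse x z Cz.
have -> : z - proj C x = (x - proj C x) - (x - z).
  by apply/rowP => j; rewrite !mxE; ring.
by rewrite dotvBr subr_le0.
Qed.

(** The convex combination of the two projections lies in C and so competes with the projection of
    the combined point; [dotv_jensen] does the rest. *)
Lemma dist_set_sqr_convex t x y : 0 <= t <= 1 ->
  dist_set C (t *: x + (1 - t) *: y) ^+ 2
    <= t * dist_set C x ^+ 2 + (1 - t) * dist_set C y ^+ 2.
Proof.
move=> t01; rewrite !(dist_set_sqr x) !(dist_set_sqr y).
apply: le_trans (dotv_jensen _ _ _ t01).
apply: le_trans (dist_set_sqr_le _ _ (convex_set_conv _ C_convex _ _ _ t01 (proj_in x) (proj_in y))) _.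
rewrite le_eqVlt; apply/orP; left; apply/eqP; congr dotv;
  by apply/rowP => j; rewrite !mxE; ring.
Qed.

End Projection.
End EuclideanGeometry.

(** * Borel measurability of vector-valued maps, coordinate by coordinate *)

Section BorelRowVectors.
Context {R : realType} {n : nat}.

Lemma measurable_coord (j : 'I_n) :
  measurable_fun [set: borel_rV R n] (fun x : borel_rV R n => (x : 'rV[R]_n) 0 j).
Proof.
apply: (measurability _ (RGenOpens.measurableE R)).
move=> _ [_ [a [b ->]] <-]; rewrite setTI; apply: sub_sigma_algebra.
apply: open_comp; last exact: interval_open.
by move=> x _; exact: coord_continuous.
Qed.

Context {d : measure_display} {T : measurableType d}.
Implicit Types f g : T -> 'rV[R]_n.

(* Every open set is the countable union of the rational boxes it contains. *)
Lemma measurable_fun_rV f :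
  (forall j, measurable_fun [set: T] (fun t => f t 0 j)) ->
  measurable_fun [set: T] (f : T -> borel_rV R n).
Proof.
move=> mf; apply: (@measurability _ _ T (borel_rV R n) setT f (@open 'rV[R]_n)) => // _ [U oU <-].
rewrite setTI.
pose box (cq : 'rV[rat]_n * rat) : set 'rV[R]_n :=
  [set x | forall j, `|ratr (cq.1 0 j) - x 0 j| < ratr cq.2].
pose F cq := [set t | box cq (f t) /\ box cq `<=` U].
have -> : f @^-1` U = \bigcup_(cq in setT) F cq.
  apply/seteqP; split=> [t /= Ut|t [cq _ [] /= b]]; last exact.
  have /nbhs_ballP[e /= e0 eU] : nbhs (f t) U by exact: open_nbhs_nbhs.
  (* The rational centre is chosen within q of f t, so points of the box are within 2 q < e of f t
     and hence in U. *)
  have [|q /[!in_itv]/= /andP[q0 qe]] := @rat_in_itvoo R 0 (e / 2).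
    by rewrite divr_gt0.
  have /choice[c cP] : forall j, exists c : rat, `|ratr c - f t 0 j| < ratr q.
    move=> j; have [|c] := @rat_in_itvoo R (f t 0 j - ratr q) (f t 0 j + ratr q).
      by rewrite ltrD2l gtrN.
    by rewrite in_itv /= => h; exists c; rewrite ltr_distl.
  exists (\row_j c j, q) => //; split=> [j|y yb] /=; first by rewrite mxE.
  apply: eU; rewrite /ball /=; split=> // i j; rewrite (ord1 i) -ball_normE /=.
  have := yb j; rewrite /= mxE => h; have := cP j => h'.
  have -> : f t 0 j - y 0 j = (ratr (c j) - y 0 j) - (ratr (c j) - f t 0 j).
    by ring.
  rewrite (le_lt_trans (ler_normB _ _)) //.
  by rewrite (splitr e) ltrD // (lt_trans _ qe).
apply: countable_bigcupT_measurable => [|[c q]]; first exact: countableP.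
(* Whether the box lies in U does not depend on t: [F] is either empty or a finite intersection of
   coordinate conditions. *)
have [bU|bU] := pselect (box (c, q) `<=` U); last first.
  by rewrite (_ : F _ = set0) //; apply/seteqP; split=> // t [].
have -> : F (c, q) = \bigcap_(j in setT) (fun t => f t 0 j) @^-1` ball (ratr (c 0 j) : R) (ratr q).
  apply/seteqP; split=> [t [bt _] j _|t h]; first exact: bt.
  by split=> // j; exact: h.
apply: fin_bigcap_measurable => // j _; rewrite -[X in measurable X]setTI.
by apply: mf => //; exact: measurable_ball.
Qed.

Lemma measurable_fun_coord f (j : 'I_n) :
  measurable_fun [set: T] (f : T -> borel_rV R n) ->
  measurable_fun [set: T] (fun t => f t 0 j).
Proof. by move=> mf; exact: (measurableT_comp (measurable_coord j) mf). Qed.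

Lemma measurable_fun_dotv f g :
  measurable_fun [set: T] (f : T -> borel_rV R n) ->
  measurable_fun [set: T] (g : T -> borel_rV R n) ->
  measurable_fun [set: T] (fun t => dotv (f t) (g t)).
Proof.
move=> mf mg; apply: measurable_sum => j.
by apply: measurable_funM; exact: measurable_fun_coord.
Qed.

Lemma measurable_fun_addv f g :
  measurable_fun [set: T] (f : T -> borel_rV R n) ->
  measurable_fun [set: T] (g : T -> borel_rV R n) ->
  measurable_fun [set: T] ((fun t => f t + g t) : T -> borel_rV R n).
Proof.
move=> mf mg; apply: measurable_fun_rV => j.
rewrite (_ : (fun t => _) = (fun t => f t 0 j + g t 0 j)).
  by apply: measurable_funD; exact: measurable_fun_coord.
by apply/funext => t; rewrite mxE.
Qed.

Lemma measurable_fun_scalev (a : R) f :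
  measurable_fun [set: T] (f : T -> borel_rV R n) ->
  measurable_fun [set: T] ((fun t => a *: f t) : T -> borel_rV R n).
Proof.
move=> mf; apply: measurable_fun_rV => j.
rewrite (_ : (fun t => _) = (fun t => a * f t 0 j)).
  by apply: measurable_funM => //; exact: measurable_fun_coord.
by apply/funext => t; rewrite mxE.
Qed.

Lemma measurable_fun_subv f g :
  measurable_fun [set: T] (f : T -> borel_rV R n) ->
  measurable_fun [set: T] (g : T -> borel_rV R n) ->
  measurable_fun [set: T] ((fun t => f t - g t) : T -> borel_rV R n).
Proof.
move=> mf mg; rewrite (_ : (fun t => _) = (fun t => f t + (-1) *: g t)).
  by apply: measurable_fun_addv => //; exact: measurable_fun_scalev.
by apply/funext => t; rewrite scaleN1r.
Qed.

Lemma measurable_fun_sumv (I : Type) (r : seq I) (h : I -> T -> 'rV[R]_n) :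
  (forall i, measurable_fun [set: T] (h i : T -> borel_rV R n)) ->
  measurable_fun [set: T] ((fun t => \sum_(i <- r) h i t) : T -> borel_rV R n).
Proof.
move=> mh; elim: r => [|i r IHr].
  by rewrite (_ : (fun t => _) = cst 0) //; apply/funext => t; rewrite big_nil.
rewrite (_ : (fun t => _) = (fun t => h i t + \sum_(i <- r) h i t)).
  exact: measurable_fun_addv.
by apply/funext => t; rewrite big_cons.
Qed.

End BorelRowVectors.

(** * Independence of a random element from a subfamily of the samples *)

Section IndependentOfFamily.
Context {R : realType} {d d' : measure_display}.
Context {Om : measurableType d} {T : measurableType d'} {Q : probability T R}.
Context {I : eqType} (Y : I -> {RV Q >-> Om}).
Implicit Types (J : set I) (A : I -> set Om) (s : seq I).

Definition sample_event s A : set T := \bigcap_(i in [set` s]) (Y i @^-1` A i).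

(** Tested on finite sample events only, to match [mutually_independent]. The set J of indices
    shrinks as samples are absorbed into Z. *)
Definition independent_of {dE} {E : measurableType dE} J (Z : T -> E) :=
  forall s A B, uniq s -> [set` s] `<=` J -> (forall i, measurable (A i)) ->
    measurable B ->
    Q (Z @^-1` B `&` sample_event s A) = (Q (Z @^-1` B) * Q (sample_event s A))%E.

Lemma sample_event_cons i s A :
  sample_event (i :: s) A = Y i @^-1` A i `&` sample_event s A.
Proof.
rewrite /sample_event -(bigcap_setU1 (fun j => Y j @^-1` A j)); congr (\bigcap_(j in _) _).
by apply/seteqP; split=> j /=; rewrite inE; [case/predU1P; [left|right]|case=> ->; rewrite ?eqxx ?orbT].
Qed.

Lemma sample_event_nil A : sample_event [::] A = setT.
Proof. by apply/seteqP; split=> // w _ j; rewrite /= in_nil. Qed.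

Lemma measurable_sample i (A : set Om) : measurable A -> measurable (Y i @^-1` A).
Proof. by move=> mA; rewrite -[X in measurable X]setTI; exact: measurable_funP. Qed.

Lemma measurable_sample_event s A :
  (forall i, measurable (A i)) -> measurable (sample_event s A).
Proof.
move=> mA; elim: s => [|i s IHs]; first by rewrite sample_event_nil.
by rewrite sample_event_cons; apply: measurableI => //; exact: measurable_sample.
Qed.

Lemma eq_sample_event s A A' :
  {in s, A =1 A'} -> sample_event s A = sample_event s A'.
Proof. by move=> AA'; apply: eq_bigcapr => i /= /AA' ->. Qed.

Lemma independent_of_cst {dE} {E : measurableType dE} J (z : E) :
  independent_of J (cst z).
Proof.
move=> s A B us sJ mA mB; rewrite preimage_cst; case: ifPn => _.
  by rewrite setTI probability_setT mul1e.
by rewrite set0I measure0 mul0e.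
Qed.

Lemma independent_of_comp {dE dF} {E : measurableType dE} {F : measurableType dF}
    J (Z : T -> E) (f : E -> F) :
  measurable_fun setT f -> independent_of J Z -> independent_of J (f \o Z).
Proof.
move=> mf indep s A B us sJ mA mB; rewrite comp_preimage.
by apply: indep => //; rewrite -[X in measurable X]setTI; exact: mf.
Qed.

Lemma independent_ofS {dE} {E : measurableType dE} J J' (Z : T -> E) :
  J' `<=` J -> independent_of J Z -> independent_of J' Z.
Proof. by move=> J'J indep s A B us sJ; apply: indep => // i /sJ/J'J. Qed.

Hypothesis Y_indep : mutually_independent Y.

Lemma prob_sample_event_cons i s A : uniq (i :: s) -> (forall i, measurable (A i)) ->
  Q (sample_event (i :: s) A) = (Q (Y i @^-1` A i) * Q (sample_event s A))%E.
Proof.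
move=> us mA; rewrite /sample_event !Y_indep ?big_cons //.
by case/andP: us.
Qed.

Lemma independent_of_pair_rect {dE} {E : measurableType dE} J (Z : T -> E) i s A B C :
  independent_of J Z -> J i -> uniq s -> [set` s] `<=` J `\ i ->
  (forall i, measurable (A i)) -> measurable B -> measurable C ->
  Q ((fun w => (Z w, Y i w)) @^-1` (B `*` C) `&` sample_event s A)
  = (Q (Z @^-1` B) * Q (Y i @^-1` C) * Q (sample_event s A))%E.
Proof.
move=> indep Ji us sJ mA mB mC.
have nis : i \notin s by apply/negP => si; case: (sJ i si) => _ /(_ erefl).
(* Since i is not in s, changing the test set at i leaves the event of s as it is, and the condition
   on [Y i] becomes one more sample event. *)
pose A' j := if j == i then C else A j.
have A'i : A' i = C by rewrite /A' eqxx.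
have mA' j : measurable (A' j) by rewrite /A'; case: ifP.
have eqA : sample_event s A = sample_event s A'.
  apply: eq_sample_event => j js; rewrite /A'; case: eqP => // ji.
  by move: nis; rewrite -ji js.
have uis : uniq (i :: s) by rewrite /= nis.
have -> : (fun w => (Z w, Y i w)) @^-1` (B `*` C) `&` sample_event s A
    = Z @^-1` B `&` sample_event (i :: s) A'.
  by rewrite sample_event_cons A'i -eqA setIA.
rewrite indep //; last first.
  by move=> j /=; rewrite inE => /predU1P[->//|js]; case: (sJ j js).
by rewrite prob_sample_event_cons // A'i -eqA muleA.
Qed.

(** Absorbing sample i into the history costs only the index i. With the sample event fixed, both
    sides respect complements and disjoint countable unions in B, and rectangles form a generating
    pi-system. *)
Lemma independent_of_pair {dE} {E : measurableType dE} J (Z : T -> E) i :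
  measurable_fun setT Z -> independent_of J Z -> J i ->
  independent_of (J `\ i) (fun w => (Z w, Y i w)).
Proof.
move=> mZ indep Ji s A B us sJ mA mB.
set W := (fun w => (Z w, Y i w)); set D := sample_event s A.
have mD : measurable D by exact: measurable_sample_event.
have mW : measurable_fun setT W by apply: measurable_fun_pair.
have mWS S : measurable S -> measurable (W @^-1` S).
  by move=> mS; rewrite -[X in measurable X]setTI; exact: mW.
have QDfin : Q D \is a fin_num by exact: fin_num_measure.
have mBs := measurable_prod_measurableType E Om.
move: (mB); rewrite {1}mBs.
move: B {mB}; apply: (dynkin_induction mBs).
- move=> _ _ [A1 mA1 [B1 mB1 <-]] [A2 mA2 [B2 mB2 <-]]; rewrite -setXI.
  by exists (A1 `&` A2); [exact: measurableI|exists (B1 `&` B2)=> //; exact: measurableI].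
- by rewrite preimage_setT setTI probability_setT mul1e.
- move=> _ [A1 mA1 [B1 mB1 <-]].
  rewrite (independent_of_pair_rect _ _ _ _ _ _ _ indep) //; congr (_ * _)%E.
  (* The empty list of samples gives the product formula for the pair alone. *)
  have := @independent_of_pair_rect _ _ J Z i [::] (fun=> setT) A1 B1 indep Ji.
  rewrite sample_event_nil setIT probability_setT mule1 => -> //.
- move=> S mS IH.
  have -> : W @^-1` (~` S) `&` D = D `\` (W @^-1` S) by rewrite setDE setIC.
  rewrite measureD //; [|exact: mWS|by rewrite ltey_eq QDfin].
  rewrite (setIC D) [X in (_ - X)%E]IH [in RHS](_ : W @^-1` (~` S) = ~` (W @^-1` S)) //.
  rewrite probability_setC; last exact: mWS.
  by rewrite muleBl ?mul1e.
- move=> F mF tF IH; rewrite preimage_bigcup setI_bigcupl.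
  have tWF : trivIset setT (fun k => W @^-1` F k).
    by apply/trivIsetP => a b _ _ ab; rewrite -preimage_setI (iffLR trivIsetP tF) // preimage_set0.
  rewrite !measure_bigcup //.
  + rewrite -[Q D]fineK // muleC -nneseriesZl //.
    by apply: eq_eseriesr => k _; rewrite [LHS]IH muleC fineK.
  + by move=> k _; exact: mWS.
  + by move=> k _; apply: measurableI => //; exact: mWS.
  + apply/trivIsetP => a b _ _ ab; rewrite setIACA setIid.
    by rewrite (iffLR trivIsetP tWF) // set0I.
Qed.

End IndependentOfFamily.

(** * Calculus of real expectations for bounded measurable functions *)

Section BoundedMeasurable.
Context {R : realType}.

(** The iterates of a fixed step are bounded uniformly over the runs, so this class, closed under
    the algebra used below, stands in for integrability and keeps expectations real-valued. *)
Definition bounded_measurable {d} {T : measurableType d} (f : T -> R) :=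
  measurable_fun [set: T] f /\ exists M, forall t, `|f t| <= M.

Section Closure.
Context {d : measure_display} {T : measurableType d}.
Implicit Types f g : T -> R.

Lemma bounded_measurable_cst (r : R) : bounded_measurable (fun _ : T => r).
Proof. by split=> //; exists `|r|. Qed.

Lemma bounded_measurableD f g : bounded_measurable f -> bounded_measurable g ->
  bounded_measurable (fun t => f t + g t).
Proof.
move=> [mf [M fM]] [mg [K gK]]; split; first exact: measurable_funD.
by exists (M + K) => t; rewrite (le_trans (ler_normD _ _)) // lerD.
Qed.

Lemma bounded_measurableM f g : bounded_measurable f -> bounded_measurable g ->
  bounded_measurable (fun t => f t * g t).
Proof.
move=> [mf [M fM]] [mg [K gK]]; split; first exact: measurable_funM.
by exists (M * K) => t; rewrite normrM ler_pM.
Qed.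

Lemma bounded_measurableZ (a : R) f : bounded_measurable f ->
  bounded_measurable (fun t => a * f t).
Proof. by move=> bf; apply: bounded_measurableM => //; exact: bounded_measurable_cst. Qed.

Lemma bounded_measurableB f g : bounded_measurable f -> bounded_measurable g ->
  bounded_measurable (fun t => f t - g t).
Proof.
move=> bf bg; rewrite (_ : (fun t => _) = (fun t => f t + (-1) * g t)).
  by apply: bounded_measurableD => //; exact: bounded_measurableZ.
by apply/funext => t; rewrite mulN1r.
Qed.

Lemma bounded_measurable_sum (I : Type) (r : seq I) (h : I -> T -> R) :
  (forall i, bounded_measurable (h i)) ->
  bounded_measurable (fun t => \sum_(i <- r) h i t).
Proof.
move=> bh; elim: r => [|i r IHr].
  rewrite (_ : (fun t => _) = (fun=> 0)); first exact: bounded_measurable_cst.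
  by apply/funext => t; rewrite big_nil.
rewrite (_ : (fun t => _) = (fun t => h i t + \sum_(i <- r) h i t)).
  exact: bounded_measurableD.
by apply/funext => t; rewrite big_cons.
Qed.

Lemma bounded_measurable_comp {d'} {T' : measurableType d'} (u : T' -> T) f :
  measurable_fun setT u -> bounded_measurable f -> bounded_measurable (f \o u).
Proof.
move=> mu [mf [M fM]]; split; first exact: measurableT_comp.
by exists M => t; exact: fM.
Qed.

Lemma bounded_measurable_le f g : measurable_fun setT f ->
  (forall t, `|f t| <= g t) -> bounded_measurable g -> bounded_measurable f.
Proof.
move=> mf fg [_ [M gM]]; split=> //; exists M => t.
by rewrite (le_trans (fg t)) // (le_trans (ler_norm _)).
Qed.

End Closure.

Section Expectation.
Context {d : measure_display} {T : measurableType d} (P : probability T R).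
Implicit Types f g : T -> R.

Lemma bounded_integrable f : bounded_measurable f -> P.-integrable setT (EFin \o f).
Proof.
move=> [mf [M fM]]; apply: measurable_bounded_integrable => //.
  by rewrite -ge0_fin_numE // fin_num_measure.
exists M; split; first exact: num_real.
by move=> K MK t _; apply: le_trans (fM t) _; exact: ltW.
Qed.

Lemma EFin_Rintegral f : bounded_measurable f ->
  (\int[P]_t f t)%:E = (\int[P]_t (f t)%:E)%E.
Proof.
move=> bf; rewrite /Rintegral fineK //; apply: integrable_fin_num => //.
exact: bounded_integrable.
Qed.

Lemma mean_cst (r : R) : \int[P]_t r = r.
Proof.
rewrite (@Rintegral_cst _ _ _ P setT) //.
by rewrite [X in fine X]probability_setT mulr1.
Qed.

Lemma meanD f g : bounded_measurable f -> bounded_measurable g ->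
  \int[P]_t (f t + g t) = \int[P]_t f t + \int[P]_t g t.
Proof. by move=> /bounded_integrable ? /bounded_integrable ?; exact: RintegralD. Qed.

Lemma meanZ (a : R) f : bounded_measurable f ->
  \int[P]_t (a * f t) = a * \int[P]_t f t.
Proof. by move=> /bounded_integrable ?; exact: RintegralZl. Qed.

Lemma meanB f g : bounded_measurable f -> bounded_measurable g ->
  \int[P]_t (f t - g t) = \int[P]_t f t - \int[P]_t g t.
Proof. by move=> /bounded_integrable ? /bounded_integrable ?; exact: RintegralB. Qed.

Lemma mean_sum (I : Type) (r : seq I) (h : I -> T -> R) :
  (forall i, bounded_measurable (h i)) ->
  \int[P]_t (\sum_(i <- r) h i t) = \sum_(i <- r) \int[P]_t h i t.
Proof.
move=> bh; elim: r => [|i r IHr].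
  by rewrite big_nil; under eq_Rintegral do rewrite big_nil; rewrite mean_cst.
rewrite big_cons -IHr -meanD //; last exact: bounded_measurable_sum.
by under eq_Rintegral do rewrite big_cons.
Qed.

Lemma le_mean f g : bounded_measurable f -> bounded_measurable g ->
  (forall t, f t <= g t) -> \int[P]_t f t <= \int[P]_t g t.
Proof. by move=> /bounded_integrable ? /bounded_integrable ? fg; exact: le_Rintegral. Qed.

Lemma mean_ge0 f : (forall t, 0 <= f t) -> 0 <= \int[P]_t f t.
Proof. by move=> f0; exact: Rintegral_ge0. Qed.

End Expectation.

(** * Integrating out an independent variable *)

Section Fubini.
Context {dE d : measure_display} {E : measurableType dE} {Om : measurableType d}.
Context (P : probability Om R).

Lemma bounded_measurable_section (f : E * Om -> R) e : bounded_measurable f ->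
  bounded_measurable (fun s => f (e, s)).
Proof.
by move=> bf; apply: (bounded_measurable_comp (pair e)) bf; exact: pair1_measurable.
Qed.

Lemma bounded_measurable_mean (f : E * Om -> R) : bounded_measurable f ->
  bounded_measurable (fun e => \int[P]_s f (e, s)).
Proof.
move=> bf; have bs e := bounded_measurable_section _ e bf; have [mf [M fM]] := bf.
have M0 : 0 <= M by rewrite (le_trans _ (fM (point, point))).
split; last first.
  exists M => e; rewrite ler_norml; apply/andP; split.
    rewrite -[leLHS](mean_cst P); apply: le_mean => //; first exact: bounded_measurable_cst.
    by move=> s; have := fM (e, s); rewrite ler_norml => /andP[].
  rewrite -[leRHS](mean_cst P); apply: le_mean => //; first exact: bounded_measurable_cst.
  by move=> s; have := fM (e, s); rewrite ler_norml => /andP[].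
(* Tonelli asks for a nonnegative integrand; the shift by M is undone at the end. *)
have f0 x : (0 <= (f x + M)%:E)%E.
  by rewrite lee_fin; have := fM x; rewrite ler_norml => /andP[]; lra.
have mF : measurable_fun setT (fun x => (f x + M)%:E).
  by apply/measurable_EFinP; exact: measurable_funD.
have := measurable_fun_fubini_tonelli_F (m2 := P) _ mF f0.
rewrite (_ : fubini_F _ _ = EFin \o (fun e => \int[P]_s f (e, s) + M)); last first.
  apply/funext => e; rewrite /fubini_F /= -[in RHS](mean_cst P M) -meanD //.
    rewrite EFin_Rintegral //; apply: bounded_measurableD => //.
    exact: bounded_measurable_cst.
  exact: bounded_measurable_cst.
move=> /measurable_EFinP mG.
rewrite (_ : (fun e => _) = (fun e => (\int[P]_s f (e, s) + M) - M)).
  exact: measurable_funB.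
by apply/funext => e; rewrite addrK.
Qed.

(* Dividing f by 1 + b reduces to a bounded integrand. *)
Lemma measurable_mean_dominated (f : E * Om -> R) (b : E -> R) :
  measurable_fun setT f -> measurable_fun setT b ->
  (forall e s, `|f (e, s)| <= b e) ->
  measurable_fun setT (fun e => \int[P]_s f (e, s)).
Proof.
move=> mf mb fb.
have b0 e : 0 <= b e by rewrite (le_trans _ (fb e point)).
have b1 e : 0 < 1 + b e by rewrite ltr_wpDr.
pose h (es : E * Om) := (1 + b es.1)^-1 * f es.
have bh : bounded_measurable h.
  split; last first.
    exists 1 => -[e s]; rewrite /h normrM ger0_norm ?invr_ge0 ?(ltW (b1 e)) //=.
    by rewrite ler_pdivrMl // mulr1 (le_trans (fb e s)) // lerDr.
  apply: measurable_funM => //.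
  rewrite (_ : (fun es : E * Om => _) = (fun es => (1 + b es.1) `^ (-1))).
    apply: (@measurableT_comp _ _ _ _ _ _ (fun z : R => z `^ (-1)) _
      (fun es : E * Om => 1 + b es.1)) => //.
    apply: measurable_funD => //.
    exact: (measurableT_comp mb measurable_fst).
  by apply/funext => es; rewrite powR_inv1 // ltW.
have [mh _] := bounded_measurable_mean _ bh.
rewrite (_ : (fun e => _) = (fun e => (1 + b e) * \int[P]_s h (e, s))).
  by apply: measurable_funM => //; exact: measurable_funD.
apply/funext => e; rewrite -meanZ; last exact: bounded_measurable_section.
by apply: eq_Rintegral => s _; rewrite /h /= mulrA mulfV ?mul1r // gt_eqF.
Qed.

Context {d' : measure_display} {T : measurableType d'} {Q : probability T R}.

(** Stands in for conditioning on Z. Independence gives the joint law of (Z, Y i) on rectangles,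
    hence makes it the product of the law of Z and P; Tonelli applies after shifting f by its
    bound. *)
Lemma mean_independent {I : eqType} {Y : I -> {RV Q >-> Om}} (J : set I) (Z : T -> E) i
    (f : E * Om -> R) :
  (forall A, measurable A -> distribution Q (Y i) A = P A) ->
  measurable_fun setT Z -> independent_of Y J Z -> J i -> bounded_measurable f ->
  \int[Q]_w f (Z w, Y i w) = \int[Q]_w (\int[P]_s f (Z w, s)).
Proof.
move=> lawY mZ indep Ji bf; have [mf [M fM]] := bf.
pose Zv : {RV Q >-> E} := HB.pack Z (isMeasurableFun.Build _ _ _ _ _ mZ).
have mW : measurable_fun setT (fun w => (Z w, Y i w)) by exact: measurable_fun_pair.
pose W : {RV Q >-> (E * Om)%type} :=
  HB.pack (fun w => (Z w, Y i w)) (isMeasurableFun.Build _ _ _ _ _ mW).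
have lawW A : measurable A -> (distribution Q Zv \x P)%E A = distribution Q W A.
  apply: product_measure_unique => B C mB mC.
  have := indep [:: i] (fun=> C) B isT.
  rewrite sample_event_cons sample_event_nil setIT => h.
  transitivity (distribution Q Zv B * distribution Q (Y i) C)%E; last first.
    by congr (_ * _)%E; exact: lawY.
  apply: h => //.
  by move=> j /=; rewrite inE => /eqP ->.
have bG := bounded_measurable_mean _ bf.
have f0 x : (0 <= (f x + M)%:E)%E.
  by rewrite lee_fin; have := fM x; rewrite ler_norml => /andP[]; lra.
have mF : measurable_fun setT (fun x => (f x + M)%:E).
  by apply/measurable_EFinP; exact: measurable_funD.
suff : \int[Q]_w (f (Z w, Y i w) + M) = \int[Q]_w ((\int[P]_s f (Z w, s)) + M).
  rewrite !meanD; try exact: bounded_measurable_cst.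
  - exact: addIr.
  - exact: (bounded_measurable_comp Z) bG.
  - exact: (bounded_measurable_comp W) bf.
apply: EFin_inj; rewrite !EFin_Rintegral; last 2 first.
- apply: bounded_measurableD; last exact: bounded_measurable_cst.
  exact: (bounded_measurable_comp Z) bG.
- apply: bounded_measurableD; last exact: bounded_measurable_cst.
  exact: (bounded_measurable_comp W) bf.
transitivity (\int[distribution Q W]_x (f x + M)%:E)%E.
  by rewrite ge0_integral_distribution.
rewrite (eq_measure_integral (distribution Q Zv \x P)%E) => [|A mA _]; last first.
  by rewrite [RHS]lawW.
rewrite fubini_tonelli1 // ge0_integral_distribution //; last first.
- by move=> e; apply: integral_ge0 => s _; exact: f0.
- exact: measurable_fun_fubini_tonelli_F.
apply: eq_integral => w _; rewrite /fubini_F /= -[in RHS](mean_cst P M) -meanD.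
- rewrite EFin_Rintegral //; apply: bounded_measurableD.
    exact: bounded_measurable_section.
  exact: bounded_measurable_cst.
- exact: bounded_measurable_section.
- exact: bounded_measurable_cst.
Qed.

Lemma clip_bounded_measurable {d1} {T1 : measurableType d1} (f : T1 -> R) M :
  0 <= M -> measurable_fun setT f ->
  bounded_measurable (fun t => Num.max (- M) (Num.min (f t) M)).
Proof.
move=> M0 mf; split.
  by apply: measurable_maxr => //; exact: measurable_minr.
exists M => t; rewrite ler_norml le_max lexx /= ge_max ge_min lexx orbT andbT.
by rewrite (le_trans _ M0) // oppr_le0.
Qed.

Lemma clip_id (M r : R) : `|r| <= M -> Num.max (- M) (Num.min r M) = r.
Proof.
by rewrite ler_norml => /andP[Mr rM]; rewrite (min_idPl rM) (max_idPr Mr).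
Qed.

(* Clipping f to [-M, M] makes it bounded without changing it along the values of Z. *)
Lemma mean_independent_bounded {I : eqType} {Y : I -> {RV Q >-> Om}} (J : set I)
    (Z : T -> E) i (f : E * Om -> R) M :
  (forall A, measurable A -> distribution Q (Y i) A = P A) ->
  measurable_fun setT Z -> independent_of Y J Z -> J i ->
  measurable_fun setT f -> (forall w s, `|f (Z w, s)| <= M) ->
  \int[Q]_w f (Z w, Y i w) = \int[Q]_w (\int[P]_s f (Z w, s)).
Proof.
move=> lawY mZ indep Ji mf fM.
have M0 : 0 <= M by rewrite (le_trans _ (fM point point)).
have := mean_independent J Z i _ lawY mZ indep Ji (clip_bounded_measurable f M M0 mf).
under eq_Rintegral do rewrite clip_id ?fM //.
move=> ->; apply: eq_Rintegral => w _; apply: eq_Rintegral => s _.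
by rewrite clip_id.
Qed.

End Fubini.
End BoundedMeasurable.

(** * The mean squared distance to the random set, as a function of the point *)

Section DistanceToRandomSet.
Context {R : realType} {n : nat} {d : measure_display} {Om : measurableType d}.
Context (P : probability Om R) (X : set 'rV[R]_n) (XS : Om -> set 'rV[R]_n).
Context (XS_random : random_closed_convex_set XS).
Context (X_sub : forall s, X `<=` XS s) (X0 : X !=set0).
Implicit Types (x y p u : 'rV[R]_n) (s : Om) (c t : R).

Local Notation r := (residual XS).

Let XS_closed s : closed (XS s). Proof. by case: XS_random. Qed.

Let XS_convex s : convex_set (XS s : set (convex_lmodType 'rV[R]_n)).
Proof. by case: XS_random. Qed.

Let XS0 s : XS s !=set0. Proof. by case: X0 => y Xy; exists y; exact: X_sub. Qed.

(** This is phi, twice the objective. A real value loses nothing: by [residual_le] the residuals at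
    x are bounded over all s. *)
Definition mean_sqdist x : R := \int[P]_s dotv (r x s) (r x s).

Lemma residual_le x y s : X y -> dotv (r x s) (r x s) <= dotv (x - y) (x - y).
Proof. by move=> Xy; apply: dotv_proj_le => //; exact: X_sub. Qed.

Lemma residual_le_dotv x y s : X y -> dotv (r x s) (r x s) <= dotv (r x s) (x - y).
Proof. by move=> Xy; apply: dotv_proj_le_dotv => //; exact: X_sub. Qed.

Lemma dist_residual x s : dist_set (XS s) x ^+ 2 = dotv (r x s) (r x s).
Proof. exact: dist_set_sqr. Qed.

Lemma measurable_residual {d'} {T : measurableType d'} (z : T -> 'rV[R]_n) (Y : T -> Om) :
  measurable_fun setT (z : T -> borel_rV R n) -> measurable_fun setT Y ->
  measurable_fun setT ((fun w => r (z w) (Y w)) : T -> borel_rV R n).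
Proof.
move=> mz mY; apply: measurable_fun_subv => //.
case: XS_random => _ _ mproj.
by apply: (measurableT_comp mproj (measurable_fun_pair mY mz)).
Qed.

Let m_residual x : measurable_fun setT ((fun s => r x s) : Om -> borel_rV R n).
Proof. by apply: measurable_residual => //; exact: measurable_cst. Qed.

Lemma bounded_measurable_residual_sqr x :
  bounded_measurable (fun s => dotv (r x s) (r x s)).
Proof.
case: X0 => y Xy; split; first exact: measurable_fun_dotv.
by exists (dotv (x - y) (x - y)) => s; rewrite ger0_norm ?dotv_ge0 ?residual_le.
Qed.

Lemma bounded_measurable_residual_coord x j :
  bounded_measurable (fun s => r x s 0 j).
Proof.
apply: (@bounded_measurable_le _ _ _ _ (fun s => 1 + dotv (r x s) (r x s))).
- exact: measurable_fun_coord.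
(* |v| <= 1 + v^2 avoids a square root in the dominating function. *)
- move=> s; have := sqr_coord_le (r x s) j; set v := r x s 0 j.
  by rewrite -[v ^+ 2]real_normK ?num_real //; have := normr_ge0 v; nra.
- apply: bounded_measurableD; first exact: bounded_measurable_cst.
  exact: bounded_measurable_residual_sqr.
Qed.

Lemma bounded_measurable_dotv_residual u x :
  bounded_measurable (fun s => dotv u (r x s)).
Proof.
apply: bounded_measurable_sum => j; apply: bounded_measurableZ.
exact: bounded_measurable_residual_coord.
Qed.

Lemma mean_residualE x j : mean_residual P XS x 0 j = \int[P]_s r x s 0 j.
Proof. by rewrite mxE unlock. Qed.

Lemma mean_dotv_residual u x :
  \int[P]_s dotv u (r x s) = dotv u (mean_residual P XS x).
Proof.
rewrite /dotv mean_sum => [|j]; last first.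
  by apply: bounded_measurableZ; exact: bounded_measurable_residual_coord.
apply: eq_bigr => j _; rewrite mean_residualE meanZ //.
exact: bounded_measurable_residual_coord.
Qed.

Lemma mean_sqdist_ge0 x : 0 <= mean_sqdist x.
Proof. by apply: mean_ge0 => s; exact: dotv_ge0. Qed.

Lemma expectation_residual x :
  ('E_P[fun s => (enorm (residual XS x s) ^+ 2)%R] = (mean_sqdist x)%:E)%E.
Proof.
rewrite unlock /mean_sqdist EFin_Rintegral; last exact: bounded_measurable_residual_sqr.
by apply: eq_integral => s _; rewrite enorm_sqr.
Qed.

Lemma objectiveE x : objective P XS x = (2^-1 * mean_sqdist x)%:E.
Proof. by rewrite /objective expectation_residual EFinM. Qed.

Lemma expectation_dist x :
  ('E_P[fun s => (dist_set (XS s) x ^+ 2)%R] = (mean_sqdist x)%:E)%E.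
Proof.
rewrite unlock /mean_sqdist EFin_Rintegral; last exact: bounded_measurable_residual_sqr.
by apply: eq_integral => s _; rewrite dist_residual.
Qed.

Lemma mean_sqdist_le x y : X y -> mean_sqdist x <= dotv (x - y) (x - y).
Proof.
move=> Xy; rewrite -[leRHS](mean_cst P); apply: le_mean => [| |s].
- exact: bounded_measurable_residual_sqr.
- exact: bounded_measurable_cst.
- exact: residual_le.
Qed.

Lemma mean_sqdist0 y : X y -> mean_sqdist y = 0.
Proof.
move=> Xy; apply/eqP; rewrite eq_le mean_sqdist_ge0 andbT.
by rewrite (le_trans (mean_sqdist_le y y Xy)) // subrr dotv0l.
Qed.

Lemma objective_minE : objective_min P XS = 0%E.
Proof.
apply/eqP; rewrite eq_le; apply/andP; split.
  case: X0 => y Xy; apply: ereal_inf_lbound; exists y => //.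
  by rewrite objectiveE mean_sqdist0 ?mulr0.
apply: le_ereal_inf_tmp => _ [x _ <-]; rewrite objectiveE lee_fin.
by rewrite mulr_ge0 // mean_sqdist_ge0.
Qed.

Lemma mean_sqdist_convex t x y : 0 <= t <= 1 ->
  mean_sqdist (t *: x + (1 - t) *: y)
    <= t * mean_sqdist x + (1 - t) * mean_sqdist y.
Proof.
move=> t01; have b := bounded_measurable_residual_sqr.
rewrite -!meanZ // -meanD; try exact: bounded_measurableZ.
apply: le_mean => [//| |s].
  by apply: bounded_measurableD; exact: bounded_measurableZ.
by rewrite -!dist_residual; apply: dist_set_sqr_convex.
Qed.

(** A quantitative substitute for continuity, which carries phi(x_k) -> 0 over to a cluster point p.
    For each s, the projection of x competes with that of p. *)
Lemma mean_sqdist_perturb p x :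
  mean_sqdist p <= 2 * mean_sqdist x + 2 * dotv (p - x) (p - x).
Proof.
have b := bounded_measurable_residual_sqr.
rewrite -[2 * dotv _ _](mean_cst P) -meanZ // -meanD; last exact: bounded_measurable_cst.
  apply: le_mean => [//| |s].
    by apply: bounded_measurableD; [exact: bounded_measurableZ|exact: bounded_measurable_cst].
  rewrite -dist_residual.
  apply: le_trans (dist_set_sqr_le _ (XS_closed s) (XS0 s) p _ (proj_in _ (XS_closed s) (XS0 s) x)) _.
  have -> : p - proj (XS s) x = r x s + (p - x).
    by apply/rowP => j; rewrite !mxE; ring.
  exact: dotv_young.
exact: bounded_measurableZ.
Qed.

Let m_residual2 : measurable_fun setT
  ((fun p : borel_rV R n * Om => r p.1 p.2) : borel_rV R n * Om -> borel_rV R n).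
Proof. by apply: measurable_residual; [exact: measurable_fst|exact: measurable_snd]. Qed.

Let m_sqdist_to (y : 'rV[R]_n) : measurable_fun setT
  (fun x : borel_rV R n => dotv ((x : 'rV[R]_n) - y) ((x : 'rV[R]_n) - y)).
Proof.
have m : measurable_fun setT
    ((fun x : borel_rV R n => (x : 'rV[R]_n) - y) : borel_rV R n -> borel_rV R n).
  by apply: measurable_fun_subv; [exact: measurable_id|exact: measurable_cst].
exact: measurable_fun_dotv.
Qed.

Lemma measurable_mean_sqdist :
  measurable_fun setT (mean_sqdist : borel_rV R n -> R).
Proof.
case: X0 => y Xy.
apply: (measurable_mean_dominated P (fun p : borel_rV R n * Om => dotv (r p.1 p.2) (r p.1 p.2))
  (fun x : borel_rV R n => dotv ((x : 'rV[R]_n) - y) ((x : 'rV[R]_n) - y))).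
- exact: measurable_fun_dotv.
- exact: m_sqdist_to.
- by move=> x s; rewrite ger0_norm ?dotv_ge0 //; exact: residual_le.
Qed.

Lemma measurable_mean_residual :
  measurable_fun setT (mean_residual P XS : borel_rV R n -> borel_rV R n).
Proof.
case: X0 => y Xy; apply: measurable_fun_rV => j.
rewrite (_ : (fun x : borel_rV R n => _) = (fun x : borel_rV R n => \int[P]_s r x s 0 j)); last first.
  by apply/funext => x; rewrite mean_residualE.
apply: (measurable_mean_dominated P (fun p : borel_rV R n * Om => r p.1 p.2 0 j)
  (fun x : borel_rV R n => 1 + dotv ((x : 'rV[R]_n) - y) ((x : 'rV[R]_n) - y))).
- exact: measurable_fun_coord.
- by apply: measurable_funD => //; exact: m_sqdist_to.
- move=> x s /=; have := sqr_coord_le (r x s) j; set v := r x s 0 j.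
  have := residual_le x y s Xy; rewrite -[v ^+ 2]real_normK ?num_real //.
  by have := normr_ge0 v; nra.
Qed.

Context (gamma : R) (gamma_ge0 : 0 <= gamma) (gammaP : gamma_bound P XS gamma).

Lemma mean_residual_sqr_le x :
  dotv (mean_residual P XS x) (mean_residual P XS x) <= gamma * mean_sqdist x.
Proof. by have := gammaP x; rewrite expectation_residual enorm_sqr -EFinM lee_fin. Qed.

(* E|r|^2 <= <E r, x - y> <= |E r| |x - y| <= (gamma E|r|^2)^(1/2) |x - y| *)
Lemma mean_sqdist_le_gamma x y : X y ->
  mean_sqdist x <= gamma * dotv (x - y) (x - y).
Proof.
move=> Xy; set D := dotv (x - y) (x - y); set g := mean_residual P XS x.
have D0 : 0 <= D by exact: dotv_ge0.
have le1 : mean_sqdist x <= dotv (x - y) g.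
  rewrite -mean_dotv_residual; apply: le_mean => [| |s].
  - exact: bounded_measurable_residual_sqr.
  - exact: bounded_measurable_dotv_residual.
  - by rewrite dotvC; exact: residual_le_dotv.
have le2 := cauchy_schwarz (x - y) g; rewrite -/D in le2.
have le3 := mean_residual_sqr_le x; rewrite -/g in le3.
(* The inequality is proved in squared form and one factor phi(x) is cancelled, so phi(x) = 0 is
   treated apart. *)
have := mean_sqdist_ge0 x; rewrite le_eqVlt => /predU1P[<-|m0].
  by rewrite mulr_ge0.
rewrite -(ler_pM2l m0) -expr2.
apply: le_trans (_ : dotv (x - y) g ^+ 2 <= _).
  by rewrite ler_pXn2r ?nnegrE ?(ltW m0) // (le_trans (ltW m0)).
apply: le_trans le2 _; have := ler_wpM2l D0 le3; lra.
Qed.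

(** A nonnegative function with zero mean vanishes almost everywhere, and a zero residual puts p in
    the set. *)
Lemma exactness_mem p : exactness P XS X -> mean_sqdist p = 0 -> X p.
Proof.
move=> -> /= p0.
have b := bounded_measurable_residual_sqr p.
have : (\int[P]_s `|(dotv (r p s) (r p s))%:E| = 0)%E.
  rewrite -[0%E]/(0%:E) -p0 EFin_Rintegral //; apply: eq_integral => s _.
  by rewrite gee0_abs // lee_fin dotv_ge0.
have mf : measurable_fun setT (fun s => (dotv (r p s) (r p s))%:E).
  by apply/measurable_EFinP; case: b.
move=> /(ae_eq_integral_abs P measurableT mf) ae0.
(* Measurability of the event comes from this description by the residual. *)
have -> : [set s | XS s p] = [set s | (dotv (r p s) (r p s))%:E = 0%E].
  apply/seteqP; split=> s /=; first by move=> Xp; rewrite /residual proj_id // subrr dotv0l.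
  move=> [/dotv_eq0/eqP]; rewrite subr_eq0 => /eqP ->; exact: proj_in.
have mA : measurable [set s | (dotv (r p s) (r p s))%:E = 0%E].
  by rewrite -[X in measurable X]setTI; apply: measurable_eqe => //; exact: measurable_cst.
have := probability_setC P (measurableC mA); rewrite setCK => ->.
rewrite [X in (_ - X)%E](_ : _ = 0%E) ?sube0 //.
apply: measure_negligible; first exact: measurableC.
by apply: negligibleS ae0 => s /= sn /(_ I).
Qed.

End DistanceToRandomSet.

Lemma measurable_dist_set_sqr {R : realType} {n : nat} (X : set 'rV[R]_n) :
  closed X -> X !=set0 ->
  measurable_fun [set: borel_rV R n] (fun x : borel_rV R n => dist_set X x ^+ 2).
Proof.
move=> cX X0; apply: (measurability _ (RGenInftyO.measurableE R)).
move=> _ [_ [a ->] <-]; rewrite setTI; apply: sub_sigma_algebra.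
(* The sublevel set is a union of open balls centered in X. *)
rewrite (_ : _ @^-1` _ =
  \bigcup_(y in X) [set x : 'rV[R]_n | dotv (y - x) (y - x) < a]).
  apply: bigcup_open => y Xy.
  change (open ((fun x => dotv (y - x) (y - x)) @^-1` [set b : R | b < a])).
  apply: open_comp; last exact: open_lt.
  by move=> x _; exact: continuous_dotv_sub.
have sub x y : dotv (x - y) (x - y) = dotv (y - x) (y - x) :> R.
  by rewrite -opprB dotvNl dotvNr opprK.
apply/seteqP; split=> x /=; rewrite in_itv /=.
  rewrite dist_set_sqr // => lta; exists (proj X x); first exact: proj_in.
  by rewrite /= sub.
by move=> [y Xy /= lta]; rewrite (le_lt_trans (dist_set_sqr_le _ _ _ _ _ Xy)) // sub.
Qed.

(** * One step of the algorithm for a fixed batch of sets *)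

Section PathwiseStep.
Context {R : realType} {n : nat} {Om : Type} {N : nat} (N_gt0 : (0 < N)%N).
Context (X : set 'rV[R]_n) (XS : Om -> set 'rV[R]_n).
Context (XS_closed : forall s, closed (XS s)).
Context (XS_convex : forall s, convex_set (XS s : set (convex_lmodType 'rV[R]_n))).
Context (X_sub : forall s, X `<=` XS s).
Implicit Types (s : 'I_N -> Om) (x y : 'rV[R]_n) (a : R).

Definition batch_residual s x : 'rV[R]_n :=
  N%:R^-1 *: \sum_(i < N) (x - proj (XS (s i)) x).

Definition batch_energy s x : R :=
  N%:R^-1 * \sum_(i < N) dotv (x - proj (XS (s i)) x) (x - proj (XS (s i)) x).

Let N0 : (N%:R : R) != 0. Proof. by rewrite pnatr_eq0 -lt0n. Qed.
Let NV0 : 0 <= (N%:R : R)^-1. Proof. by rewrite invr_ge0. Qed.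

Lemma spa_stepE a s x : spa_step XS a s x = x - a *: batch_residual s x.
Proof.
rewrite /spa_step /batch_residual sumrB sumr_const card_ord; congr (_ - _ *: _).
by rewrite scalerBr -[x *+ N]scaler_nat scalerA mulVf // scale1r.
Qed.

Lemma batch_energy_ge0 s x : 0 <= batch_energy s x.
Proof. by rewrite mulr_ge0 // sumr_ge0 // => i _; exact: dotv_ge0. Qed.

Lemma batch_residual_sqrE s x :
  dotv (batch_residual s x) (batch_residual s x)
  = N%:R^-1 ^+ 2 * \sum_(i < N) \sum_(j < N)
      dotv (x - proj (XS (s i)) x) (x - proj (XS (s j)) x).
Proof.
rewrite /batch_residual dotvZl dotvZr mulrA -expr2 dotv_suml; congr (_ * _).
by apply: eq_bigr => i _; rewrite dotv_sumr.
Qed.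

(** Convexity of the squared norm, obtained by summing <r_i, r_j> <= (|r_i|^2 + |r_j|^2) / 2 over
    all pairs. *)
Lemma batch_residual_sqr_le s x :
  dotv (batch_residual s x) (batch_residual s x) <= batch_energy s x.
Proof.
rewrite batch_residual_sqrE /batch_energy expr2 -mulrA ler_wpM2l //.
set q := fun i => dotv (x - proj (XS (s i)) x) (x - proj (XS (s i)) x).
rewrite -/(q) ler_pdivrMl ?ltr0n //.
apply: le_trans (_ : \sum_(i < N) \sum_(j < N) (q i / 2 + q j / 2) <= _).
  apply: ler_sum => i _; apply: ler_sum => j _.
  rewrite /q; move: (x - _) (x - proj (XS (s j)) x) => u v.
  by have := dotv_ge0 (u - v); rewrite !dotvE (dotvC v u); lra.
have inner i : \sum_(j < N) (q i / 2 + q j / 2)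
    = N%:R * (q i / 2) + (\sum_(j < N) q j) / 2.
  by rewrite big_split sumr_const card_ord /= -mulr_suml mulr_natl.
rewrite (eq_bigr _ (fun i _ => inner i)) big_split sumr_const card_ord /=.
by rewrite -mulr_sumr -mulr_suml -[_ *+ N]mulr_natl; lra.
Qed.

(** The last term is kept as it is because it is bounded in two ways later: by gamma_N phi in mean,
    and by [batch_energy] along a single run. *)
Lemma spa_step_sqdist a s x y : 0 <= a -> X y ->
  dotv (spa_step XS a s x - y) (spa_step XS a s x - y)
  <= dotv (x - y) (x - y) - 2 * a * batch_energy s x
     + a ^+ 2 * dotv (batch_residual s x) (batch_residual s x).
Proof.
move=> a0 Xy; rewrite spa_stepE.
have -> : x - a *: batch_residual s x - y = (x - y) - a *: batch_residual s x.
  by rewrite addrAC.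
have le : batch_energy s x <= dotv (batch_residual s x) (x - y).
  rewrite /batch_energy /batch_residual dotvZl dotv_suml ler_wpM2l //.
  apply: ler_sum => i _; apply: dotv_proj_le_dotv => //; last exact: X_sub.
  by exists y; exact: X_sub.
move: (x - y) (batch_residual s x) (batch_energy s x) le => u g e le.
have := ler_wpM2l a0 le; rewrite dotvBl !dotvBr !dotvZl !dotvZr (dotvC u g); lra.
Qed.

End PathwiseStep.

(** * Deterministic convergence: quasi-Fejer sequences and weighted averages *)

Section FejerConvergence.
Context {R : realType} {n : nat}.
Implicit Types (x : nat -> 'rV[R]_n) (p y : 'rV[R]_n) (a v : nat -> R).

Lemma cvg_rV_dotv x p :
  (forall e : R, 0 < e -> \forall k \near \oo, dotv (x k - p) (x k - p) < e) ->
  x @ \oo --> p.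
Proof.
move=> h; apply/cvgrPdist_lt => e e0.
have := h (e ^+ 2) (exprn_gt0 2 e0); apply: filterS => k.
rewrite -enorm_sqr ltr_pXn2r ?nnegrE ?enorm_ge0 ?(ltW e0) // => lte.
by rewrite distrC (le_lt_trans (normr_le_enorm _)).
Qed.

(** The partial sums increase to a finite supremum; once within e of it they cannot move by e. *)
Lemma summable_tail v (C : R) : (forall k, 0 <= v k) ->
  (forall K, \sum_(i < K) v i <= C) ->
  forall e, 0 < e -> exists K, forall k m, (K <= k)%N -> (k <= m)%N ->
    \sum_(i < m) v i - \sum_(i < k) v i < e.
Proof.
move=> v0 vC e e0.
pose S := [set s | exists K, s = \sum_(i < K) v i].
have Ssup : has_sup S.
  split; first by exists (\sum_(i < 0) v i), 0%N.
  by exists C => _ [K ->].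
have [_ [K ->] ltK] := sup_adherent e0 Ssup.
exists K => k m Kk km.
have le1 : \sum_(i < m) v i <= sup S by apply: sup_upper_bound => //; exists m.
have : \sum_(i < K) v i <= \sum_(i < k) v i.
  rewrite -!(big_mkord xpredT v) (big_cat_nat (leq0n K) Kk) /= lerDl.
  by apply: sumr_ge0.
lra.
Qed.

Lemma quasi_fejer_le x v (A : R) y :
  (forall k, dotv (x k.+1 - y) (x k.+1 - y) <= dotv (x k - y) (x k - y) + A * v k) ->
  forall k m, (k <= m)%N -> dotv (x m - y) (x m - y) <=
    dotv (x k - y) (x k - y) + A * (\sum_(i < m) v i - \sum_(i < k) v i).
Proof.
move=> step k m; elim: m => [|m IHm].
  by rewrite leqn0 => /eqP ->; rewrite subrr mulr0 addr0.
rewrite leq_eqVlt => /predU1P[->|]; first by rewrite subrr mulr0 addr0.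
move=> /IHm le; apply: le_trans (step m) _.
by rewrite big_ord_recr /=; lra.
Qed.

(** The orbit is bounded, so it has a cluster point p, which lies in X by assumption. The step
    inequality therefore holds with y = p: once the orbit is near p and the remaining errors are
    small, it stays near p. *)
Lemma quasi_fejer_cvg (X : set 'rV[R]_n) x v (A C : R) :
  X !=set0 -> 0 <= A -> (forall k, 0 <= v k) -> (forall K, \sum_(i < K) v i <= C) ->
  (forall y k, X y ->
     dotv (x k.+1 - y) (x k.+1 - y) <= dotv (x k - y) (x k - y) + A * v k) ->
  (forall p, (forall e K, 0 < e ->
                exists2 k, (K <= k)%N & dotv (x k - p) (x k - p) < e) -> X p) ->
  exists2 p, X p &
    forall e : R, 0 < e -> \forall k \near \oo, dotv (x k - p) (x k - p) < e.
Proof.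
move=> [y Xy] A0 v0 vC step clusterX.
pose M := dotv (x 0%N - y) (x 0%N - y) + A * C.
have xM k : dotv (x k - y) (x k - y) <= M.
  apply: le_trans (quasi_fejer_le _ _ _ _ (fun k => step y k Xy) _ _ (leq0n k)) _.
  by rewrite lerD2l big_ord0 subr0 ler_wpM2l.
pose B := [set z : 'rV[R]_n | dotv (y - z) (y - z) <= M].
have cB : compact B.
  apply: bounded_closed_compact.
    exists (`|y| + Num.sqrt M); split; first exact: num_real.
    move=> K ltK z /= zM; apply/ltW; apply: le_lt_trans ltK.
    rewrite -[z](subKr y) (le_trans (ler_normB _ _)) // lerD2l.
    apply: le_trans (normr_le_enorm _) _.
    by rewrite -[enorm _]ger0_norm ?enorm_ge0 // -sqrtr_sqr enorm_sqr ler_wsqrtr.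
  change (closed ((fun z => dotv (y - z) (y - z)) @^-1` [set b : R | b <= M])).
  apply: closed_comp; last exact: closed_le.
  by move=> z _; exact: continuous_dotv_sub.
have xB : (x @ \oo) B.
  by exists 0%N => // k _; rewrite /B /= -opprB dotvNl dotvNr opprK.
have [p [_ px]] := cB (x @ \oo) _ xB.
have sub u : dotv (p - u) (p - u) = dotv (u - p) (u - p).
  by rewrite -opprB dotvNl dotvNr opprK.
have pcl e K : 0 < e -> exists2 k, (K <= k)%N & dotv (x k - p) (x k - p) < e.
  move=> e0; have tailK : (x @ \oo) (x @` [set k | (K <= k)%N]).
    by exists K => // k Kk; exists k.
  have nbp : nbhs p [set z : 'rV[R]_n | dotv (p - z) (p - z) < e].
    have := @continuous_dotv_sub R n p p [set b | b < e]; apply.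
    by apply: open_nbhs_nbhs; split; [exact: open_lt|rewrite /= subrr dotv0l].
  by have [_ [[k Kk <-] /= ltk]] := px _ _ tailK nbp; exists k; rewrite // -sub.
exists p => [|e e0]; first exact: clusterX.
(* Makes A times the tail at most e / 2; the 1 covers A = 0. *)
have [K tail] := summable_tail _ _ v0 vC (e / 2 / (A + 1)) ltac:(by rewrite !divr_gt0 // ltr_wpDl).
have [k Kk xk] := pcl (e / 2) K (divr_gt0 e0 (ltr0n R 2)).
exists k => // m /= km.
apply: le_lt_trans (quasi_fejer_le _ _ _ _ (fun k => step p k (clusterX p pcl)) _ _ km) _.
have := tail k m Kk km; rewrite ltr_pdivlMr ?ltr_wpDl //.
set t := _ - _ => lt.
have t0 : 0 <= t.
  rewrite /t -!(big_mkord xpredT v) (big_cat_nat (leq0n k) km) /= addrAC subrr add0r.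
  exact: sumr_ge0.
by lra.
Qed.

(** Jensen with the denominator cleared, by merging the earlier points into their average, of weight
    s / (s + a). It is applied to phi and to the squared distance from a limit. *)
Lemma convex_weighted_avg (f : 'rV[R]_n -> R) a x k :
  (forall t u w, 0 <= t <= 1 -> f (t *: u + (1 - t) *: w) <= t * f u + (1 - t) * f w) ->
  (forall i, 0 < a i) ->
  (\sum_(i < k.+1) a i) * f ((\sum_(i < k.+1) a i)^-1 *: \sum_(i < k.+1) a i *: x i)
    <= \sum_(i < k.+1) a i * f (x i).
Proof.
move=> cf a0; elim: k => [|k IHk].
  by rewrite !big_ord1 scalerA mulVf ?gt_eqF // scale1r.
rewrite [\sum_(i < k.+2) a i *: _]big_ord_recr [\sum_(i < k.+2) _ * _]big_ord_recr.
rewrite [\sum_(i < k.+2) a i]big_ord_recr /=.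
set s := \sum_(i < k.+1) a i in IHk *; set z := \sum_(i < k.+1) a i *: x i in IHk *.
have s0 : 0 < s.
  by rewrite /s big_ord_recr /= ltr_wpDl // sumr_ge0 // => i _; exact: ltW.
have sa : 0 < s + a k.+1 by rewrite addr_gt0.
have t01 : 0 <= s / (s + a k.+1) <= 1.
  by rewrite divr_ge0 ?(ltW s0) ?(ltW sa) //= ler_pdivrMr // mul1r lerDl ltW.
have -> : (s + a k.+1)^-1 *: (z + a k.+1 *: x k.+1)
    = (s / (s + a k.+1)) *: (s^-1 *: z) + (1 - s / (s + a k.+1)) *: x k.+1.
  rewrite scalerDr !scalerA; congr (_ *: _ + _ *: _); field; rewrite ?gt_eqF //.
apply: le_trans (_ : s * f (s^-1 *: z) + a k.+1 * f (x k.+1) <= _); last by rewrite lerD2r.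
apply: le_trans (ler_wpM2l (ltW sa) (cf _ _ _ t01)) _.
rewrite le_eqVlt; apply/orP; left; apply/eqP; field; rewrite ?gt_eqF //.
Qed.

(** By convexity it suffices to average the squared distances. Beyond some K they are below e / 2,
    and the head is a fixed amount while the total weight grows at least like k delta. *)
Lemma weighted_cesaro a x p (delta : R) : 0 < delta -> (forall i, delta <= a i) ->
  (forall e : R, 0 < e -> \forall k \near \oo, dotv (x k - p) (x k - p) < e) ->
  forall e : R, 0 < e -> \forall k \near \oo,
    dotv ((\sum_(i < k) a i)^-1 *: (\sum_(i < k) a i *: x i) - p)
         ((\sum_(i < k) a i)^-1 *: (\sum_(i < k) a i *: x i) - p) < e.
Proof.
move=> d0 da xp e e0.
have [K _ xK] := xp (e / 2) (divr_gt0 e0 (ltr0n R 2)).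
pose u i := dotv (x i - p) (x i - p).
have a0 i : 0 < a i by exact: lt_le_trans (da i).
pose B := \sum_(0 <= i < K) a i * u i.
have B0 : 0 <= B by rewrite sumr_ge0 // => i _; rewrite mulr_ge0 ?dotv_ge0 // ltW.
(* From L terms on, the total weight is at least L delta, so the head B takes less than the other
   half of e. *)
have [L LB] : exists L : nat, B < L%:R * (delta * (e / 2)).
  exists (Num.truncn (B / (delta * (e / 2)))).+1.
  by rewrite -ltr_pdivrMr ?mulr_gt0 ?divr_gt0 //; exact: truncnS_gt.
(* The successor also excludes k = 0, where the weights sum to 0. *)
exists (maxn K L).+1 => // -[//|k]; rewrite /= ltnS geq_max => /andP[Kk Lk].
set s := \sum_(i < k.+1) a i.
have sk : k.+1%:R * delta <= s.
  rewrite /s mulr_natl -[X in _ *+ X]card_ord -sumr_const; exact: ler_sum.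
have s0 : 0 < s by rewrite (lt_le_trans _ sk) // mulr_gt0.
rewrite -(ltr_pM2l s0).
have cf t (w z : 'rV[R]_n) : 0 <= t <= 1 ->
    dotv (t *: w + (1 - t) *: z - p) (t *: w + (1 - t) *: z - p)
    <= t * dotv (w - p) (w - p) + (1 - t) * dotv (z - p) (z - p).
  move=> t01; have := dotv_jensen t (w - p) (z - p) t01.
  have -> : t *: (w - p) + (1 - t) *: (z - p) = t *: w + (1 - t) *: z - p.
    by apply/rowP => j; rewrite !mxE; ring.
  by [].
apply: le_lt_trans (convex_weighted_avg (fun z => dotv (z - p) (z - p)) a x k cf a0) _.
rewrite -(big_mkord xpredT (fun i => a i * u i)) (big_cat_nat (leq0n K) (leqW Kk)) /= -/B.
have le : \sum_(K <= i < k.+1) a i * u i <= s * (e / 2).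
  apply: le_trans (_ : \sum_(K <= i < k.+1) a i * (e / 2) <= _).
    rewrite !big_nat; apply: ler_sum => i /andP[Ki _].
    by rewrite ler_wpM2l ?(ltW (a0 i)) // ltW //; exact: xK.
  rewrite -mulr_suml ler_wpM2r ?(ltW (divr_gt0 e0 (ltr0n R 2))) //.
  rewrite /s -(big_mkord xpredT a) (big_cat_nat (leq0n K) (leqW Kk)) /= lerDr.
  by rewrite sumr_ge0 // => i _; exact: ltW.
have : L%:R * delta <= s by rewrite (le_trans _ sk) // ler_wpM2r ?(ltW d0) // ler_nat leqW.
move=> /(ler_wpM2r (ltW (divr_gt0 e0 (ltr0n R 2)))); rewrite -mulrA; lra.
Qed.

End FejerConvergence.

Lemma descent_sum_le {R : realType} (D b : nat -> R) (c : R) :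
  (forall k, 0 <= D k) -> (forall k, D k.+1 + c * b k <= D k) ->
  forall k, c * \sum_(i < k) b i <= D 0%N.
Proof.
move=> D0 dec k; suff : D k + c * \sum_(i < k) b i <= D 0%N by have := D0 k; lra.
elim: k => [|k IHk]; first by rewrite big_ord0 mulr0 addr0.
by rewrite big_ord_recr /= mulrDr; have := dec k; lra.
Qed.

(** * The random iterates: independence, boundedness and mean descent *)

Section StochasticProcess.
Context {R : realType} {n : nat} {d : measure_display} {Om : measurableType d}.
Context (P : probability Om R) (X : set 'rV[R]_n) (XS : Om -> set 'rV[R]_n).
Context (X_closed : closed X) (XS_random : random_closed_convex_set XS).
Context (X_sub : forall s, X `<=` XS s) (X0 : X !=set0).
Context (gamma : R) (gamma_ge0 : 0 <= gamma) (gammaP : gamma_bound P XS gamma).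
Context (N : nat) (N_gt0 : (0 < N)%N).
Context {d' : measure_display} {T : measurableType d'} (Q : probability T R).
Context (S : nat -> 'I_N -> {RV Q >-> Om}) (S_iid : iid_samples P S).
Context (x0 : 'rV[R]_n) (alpha : nat -> R) (alpha_ge0 : forall k, 0 <= alpha k).
Context (x : nat -> T -> 'rV[R]_n) (x_init : forall w, x 0%N w = x0).
Context (x_step : forall k w,
  x k.+1 w = spa_step XS (alpha k) (fun i => S k i w) (x k w)).

Local Notation r := (residual XS).
Local Notation phi := (mean_sqdist P XS).
Local Notation E := (borel_rV R n).
Local Notation samples := (fun ki : nat * 'I_N => S ki.1 ki.2).

Let XS_closed s : closed (XS s). Proof. by case: XS_random. Qed.

Let XS_convex s : convex_set (XS s : set (convex_lmodType 'rV[R]_n)).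
Proof. by case: XS_random. Qed.

Let samples_law ki A : measurable A -> distribution Q (samples ki) A = P A.
Proof. by case: S_iid => law _ mA; exact: law. Qed.

Let samples_indep : mutually_independent samples.
Proof. by case: S_iid. Qed.

(* Samples still unused after m projections of iteration k. *)
Let unused k m : set (nat * 'I_N) :=
  [set ki : nat * 'I_N | (k < ki.1)%N || (ki.1 == k) && (m <= ki.2)%N].

(** The history in the middle of iteration k. The iterate is carried along because all N projections
    are taken at it. *)
Let partial k m w : E * E :=
  (x k w, \sum_(i < N | (i < m)%N) proj (XS (S k i w)) (x k w)).

Let partial_next (ps : (E * E) * Om) : E * E :=
  (ps.1.1, (ps.1.2 : 'rV[R]_n) + proj (XS ps.2) ps.1.1).

Let partialS k m (mN : (m < N)%N) w :
  partial k m.+1 w = partial_next (partial k m w, S k (Ordinal mN) w).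
Proof.
rewrite /partial /partial_next /=; congr (_, _).
rewrite (bigD1 (Ordinal mN)) //= addrC; congr (_ + _).
apply: eq_bigl => i; rewrite ltnS [in RHS]ltn_neqAle andbC; congr (_ && _).
Qed.

Let m_partial_next : measurable_fun setT partial_next.
Proof.
apply: measurable_fun_pair; first exact: (measurableT_comp measurable_fst measurable_fst).
apply: measurable_fun_addv; first exact: (measurableT_comp measurable_snd measurable_fst).
case: XS_random => _ _ mproj.
exact: (measurableT_comp mproj
  (measurable_fun_pair measurable_snd (measurableT_comp measurable_fst measurable_fst))).
Qed.

Let finish_step (a : R) (p : E * E) : E :=
  (p.1 : 'rV[R]_n) - a *: ((p.1 : 'rV[R]_n) - N%:R^-1 *: (p.2 : 'rV[R]_n)).

Let m_finish_step a : measurable_fun setT (finish_step a).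
Proof.
apply: measurable_fun_subv; first exact: measurable_fst.
apply: measurable_fun_scalev; apply: measurable_fun_subv; first exact: measurable_fst.
by apply: measurable_fun_scalev; exact: measurable_snd.
Qed.

Lemma spa_adapted k : measurable_fun setT (x k : T -> E) /\
  independent_of samples (unused k 0) (x k : T -> E).
Proof.
elim: k => [|k [mx ix]].
  rewrite (_ : x 0%N = cst x0); last by apply/funext => w; exact: x_init.
  by split; [exact: measurable_cst|exact: independent_of_cst].
have part m : (m <= N)%N -> measurable_fun setT (partial k m) /\
    independent_of samples (unused k m) (partial k m).
  elim: m => [_|m IHm mN].
    rewrite (_ : partial k 0 = (fun p : E => (p, 0 : 'rV[R]_n) : E * E) \o x k); last first.
      by apply/funext => w; rewrite /partial /= big_pred0.
    have m0 : measurable_fun setT (fun p : E => (p, 0 : 'rV[R]_n) : E * E).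
      by apply: measurable_fun_pair; [exact: measurable_id|exact: measurable_cst].
    by split; [exact: (measurableT_comp m0)|exact: independent_of_comp].
  have [mp ip] := IHm (ltnW mN).
  rewrite (_ : partial k m.+1 =
      partial_next \o (fun w => (partial k m w, samples (k, Ordinal mN) w))); last first.
    by apply/funext => w; exact: partialS.
  split.
    apply: (measurableT_comp m_partial_next).
    by apply: measurable_fun_pair => //; exact: measurable_funP.
  apply: independent_of_comp => //.
  apply: (independent_ofS _ (unused k m `\ (k, Ordinal mN))); last first.
    by apply: independent_of_pair => //; rewrite /unused /= eqxx leqnn orbT.
  rewrite /unused => -[k' i] /= /orP[kk'|/andP[/eqP -> mi]]; split.
  - by rewrite kk'.
  - by case=> k'k _; rewrite k'k ltnn in kk'.
  - by rewrite eqxx (ltnW mi) orbT.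
  - by case=> ii; rewrite ii /= ltnn in mi.
have [mp ip] := part N (leqnn N).
rewrite (_ : x k.+1 = finish_step (alpha k) \o partial k N); last first.
  apply/funext => w; rewrite x_step /spa_step /finish_step /partial /=.
  by congr (_ - _ *: (_ - _ *: _)); apply: eq_bigl => i; rewrite ltn_ord.
split; first exact: (measurableT_comp (m_finish_step _) mp).
apply: independent_of_comp; first exact: m_finish_step.
apply: independent_ofS ip; rewrite /unused => -[k' i] /= /orP[|/andP[/eqP -> _]].
  by move=> /ltnW ->.
by rewrite ltnSn.
Qed.

Lemma measurable_iterate k : measurable_fun setT (x k : T -> E).
Proof. by case: (spa_adapted k). Qed.

Let m_sample_residual k i :
  measurable_fun setT ((fun w => r (x k w) (S k i w)) : T -> E).
Proof.
by apply: measurable_residual => //; exact: measurable_iterate.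
Qed.

(** The estimate for single runs, with the negative term dropped. It yields both the uniform bounds
    on iterates and the quasi-Fejer property. *)
Lemma iterate_step_le k w y : X y ->
  dotv (x k.+1 w - y) (x k.+1 w - y) <= dotv (x k w - y) (x k w - y)
    + alpha k ^+ 2 * batch_energy XS (fun i => S k i w) (x k w).
Proof.
move=> Xy; rewrite x_step.
apply: le_trans (spa_step_sqdist N_gt0 X XS XS_closed XS_convex X_sub _ _ _ _ (alpha_ge0 k) Xy) _.
have := ler_wpM2l (sqr_ge0 (alpha k))
  (batch_residual_sqr_le N_gt0 XS (fun i => S k i w) (x k w)).
have := mulr_ge0 (alpha_ge0 k) (batch_energy_ge0 XS (fun i => S k i w) (x k w)).
lra.
Qed.

Lemma batch_energy_le (s : 'I_N -> Om) (z y : 'rV[R]_n) : X y ->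
  batch_energy XS s z <= dotv (z - y) (z - y).
Proof.
move=> Xy; rewrite /batch_energy ler_pdivrMl ?ltr0n //.
rewrite mulr_natl -[X in _ *+ X]card_ord -sumr_const; apply: ler_sum => i _.
exact: (residual_le X XS XS_random X_sub).
Qed.

(** M may grow with k but not vary with w, which is what makes the quantities of each step bounded
    random variables. *)
Lemma iterate_bounded y : X y -> forall k, exists M, forall w,
  dotv (x k w - y) (x k w - y) <= M.
Proof.
move=> Xy; elim=> [|k [M xM]].
  by exists (dotv (x0 - y) (x0 - y)) => w; rewrite x_init.
exists (M + alpha k ^+ 2 * M) => w.
apply: le_trans (iterate_step_le k w y Xy) _; rewrite lerD // ler_wpM2l ?sqr_ge0 //.
exact: le_trans (batch_energy_le _ _ _ Xy) (xM w).
Qed.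

Let dotv_bound (u v : 'rV[R]_n) M : dotv u u <= M -> dotv v v <= M -> `|dotv u v| <= M.
Proof.
move=> uM vM; rewrite ler_norml.
have := dotv_ge0 (u + v); have := dotv_ge0 (u - v); rewrite !dotvE (dotvC v u).
by move=> h1 h2; apply/andP; split; lra.
Qed.

Let residual_bounded k : exists M, forall w s, dotv (r (x k w) s) (r (x k w) s) <= M.
Proof.
case: X0 => y Xy; have [M xM] := iterate_bounded y Xy k; exists M => w s.
by apply: le_trans (xM w); exact: (residual_le X).
Qed.

Lemma bounded_measurable_phi k : bounded_measurable (fun w => phi (x k w)).
Proof.
split.
  exact: (measurableT_comp (measurable_mean_sqdist P X XS XS_random X_sub X0)
    (measurable_iterate k)).
case: X0 => y Xy; have [M xM] := iterate_bounded y Xy k; exists M => w.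
by rewrite ger0_norm ?mean_sqdist_ge0 // (le_trans (mean_sqdist_le P X _ _ _ _ _ _ Xy)).
Qed.

Let bounded_measurable_pair k i j :
  bounded_measurable (fun w => dotv (r (x k w) (S k i w)) (r (x k w) (S k j w))).
Proof.
split; first exact: measurable_fun_dotv.
by have [M rM] := residual_bounded k; exists M => w; exact: dotv_bound.
Qed.

Let mean_pair_same k i :
  \int[Q]_w dotv (r (x k w) (S k i w)) (r (x k w) (S k i w)) = \int[Q]_w phi (x k w).
Proof.
have [M rM] := residual_bounded k; have [mx ix] := spa_adapted k.
apply: (mean_independent_bounded P (unused k 0) (x k : T -> E) (k, i)
  (fun p : E * Om => dotv (r p.1 p.2) (r p.1 p.2)) M (samples_law _) mx ix).
- by rewrite /unused /= eqxx orbT.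
- have m := measurable_residual XS XS_random (fun p : E * Om => p.1 : 'rV[R]_n)
    (fun p : E * Om => p.2) measurable_fst measurable_snd.
  exact: measurable_fun_dotv.
- by move=> w s /=; rewrite ger0_norm ?dotv_ge0.
Qed.

(** Two averagings: first over sample j, with the pair of x_k and sample i as history, then over
    sample i, with x_k alone as history. *)
Let mean_pair_diff k i j : i != j ->
  \int[Q]_w dotv (r (x k w) (S k i w)) (r (x k w) (S k j w))
  = \int[Q]_w dotv (mean_residual P XS (x k w)) (mean_residual P XS (x k w)).
Proof.
move=> ij; have [M rM] := residual_bounded k; have [mx ix] := spa_adapted k.
have m1 := measurable_residual XS XS_random (fun p : E * Om => p.1 : 'rV[R]_n)
    (fun p : E * Om => p.2) measurable_fst measurable_snd.
have m2 := measurable_residual XS XS_random (fun p : E * Om * Om => p.1.1 : 'rV[R]_n)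
  (fun p : E * Om * Om => p.2) (measurableT_comp measurable_fst measurable_fst)
  measurable_snd.
have m3 := measurable_residual XS XS_random (fun p : E * Om * Om => p.1.1 : 'rV[R]_n)
  (fun p : E * Om * Om => p.1.2) (measurableT_comp measurable_fst measurable_fst)
  (measurableT_comp measurable_snd measurable_fst).
have uki : unused k 0 (k, i) by rewrite /unused /= eqxx orbT.
transitivity (\int[Q]_w dotv (r (x k w) (S k i w)) (mean_residual P XS (x k w))).
  rewrite (mean_independent_bounded P (unused k 0 `\ (k, i))
    (fun w => (x k w : E, samples (k, i) w)) (k, j)
    (fun p : E * Om * Om => dotv (r p.1.1 p.1.2) (r p.1.1 p.2)) M (samples_law _)) //.
  - by apply: eq_Rintegral => w _ /=; rewrite (mean_dotv_residual P X).
  - by apply: measurable_fun_pair => //; exact: measurable_funP.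
  - exact: independent_of_pair.
  - split; first by rewrite /unused /= eqxx orbT.
    by case=> ji; rewrite ji eqxx in ij.
  - exact: measurable_fun_dotv.
  - by move=> w s /=; exact: dotv_bound.
(* [dotv_bound] takes a common bound: M serves for the residual, gamma M for its mean, and their sum
   for both. *)
rewrite (mean_independent_bounded P (unused k 0) (x k : T -> E) (k, i)
  (fun p : E * Om => dotv (r p.1 p.2) (mean_residual P XS p.1)) (M + gamma * M) (samples_law _)) //.
- apply: eq_Rintegral => w _; rewrite -(mean_dotv_residual P X) //.
  by apply: eq_Rintegral => s _; rewrite dotvC.
- apply: measurable_fun_dotv => //.
  exact: (measurableT_comp (measurable_mean_residual P X XS XS_random X_sub X0) measurable_fst).
- move=> w s /=; have M0 : 0 <= M by rewrite (le_trans _ (rM point point)) ?dotv_ge0.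
  apply: dotv_bound; first by rewrite (le_trans (rM w s)) // lerDl mulr_ge0.
  apply: le_trans (mean_residual_sqr_le P X _ XS_random X_sub X0 _ gammaP _) _.
  rewrite -[leLHS]add0r lerD // ler_wpM2l // -[leRHS](mean_cst P).
  apply: le_mean => [| |s']; [|exact: bounded_measurable_cst|exact: rM].
  exact: (bounded_measurable_residual_sqr X).
Qed.

Let energy k w := batch_energy XS (fun i => S k i w) (x k w).

Lemma bounded_measurable_energy k : bounded_measurable (energy k).
Proof.
apply: bounded_measurableZ; apply: bounded_measurable_sum => i.
exact: bounded_measurable_pair.
Qed.

Lemma mean_energy k : \int[Q]_w energy k w = \int[Q]_w phi (x k w).
Proof.
rewrite /energy /batch_energy meanZ; last first.
  by apply: bounded_measurable_sum => i; exact: bounded_measurable_pair.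
rewrite mean_sum => [|i]; last exact: bounded_measurable_pair.
rewrite (eq_bigr _ (fun i _ => mean_pair_same k i)) sumr_const card_ord.
by rewrite -[X in _ * X]mulr_natl mulKf // pnatr_eq0 -lt0n.
Qed.

Let noise k w := dotv (batch_residual XS (fun i => S k i w) (x k w))
                      (batch_residual XS (fun i => S k i w) (x k w)).

Lemma bounded_measurable_noise k : bounded_measurable (noise k).
Proof.
rewrite (_ : noise k = (fun w => N%:R^-1 ^+ 2 * \sum_(i < N) \sum_(j < N)
    dotv (r (x k w) (S k i w)) (r (x k w) (S k j w)))); last first.
  by apply/funext => w; rewrite /noise batch_residual_sqrE.
apply: bounded_measurableZ; do 2 apply: bounded_measurable_sum => ?.
exact: bounded_measurable_pair.
Qed.

Let gammaN : R := N%:R^-1 + (1 - N%:R^-1) * gamma.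

(* The N diagonal terms contribute phi each, the other N(N - 1) at most gamma * phi. *)
Lemma mean_noise_le k :
  \int[Q]_w noise k w
    <= gammaN * \int[Q]_w phi (x k w).
Proof.
have bsum i : bounded_measurable (fun w => \sum_(j < N)
    dotv (r (x k w) (S k i w)) (r (x k w) (S k j w))).
  by apply: bounded_measurable_sum => j; exact: bounded_measurable_pair.
rewrite (_ : noise k = (fun w => N%:R^-1 ^+ 2 * \sum_(i < N) \sum_(j < N)
    dotv (r (x k w) (S k i w)) (r (x k w) (S k j w)))); last first.
  by apply/funext => w; rewrite /noise batch_residual_sqrE.
rewrite meanZ; last exact: bounded_measurable_sum.
rewrite mean_sum //; set p := \int[Q]_w phi (x k w).
have gp : \int[Q]_w dotv (mean_residual P XS (x k w)) (mean_residual P XS (x k w))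
    <= gamma * p.
  rewrite /p -meanZ; last exact: bounded_measurable_phi.
  have le w := mean_residual_sqr_le P X _ XS_random X_sub X0 _ gammaP (x k w).
  apply: le_mean => //; last by apply: bounded_measurableZ; exact: bounded_measurable_phi.
  apply: bounded_measurable_le (fun w => gamma * phi (x k w)) _ _ _.
  - have m := measurableT_comp (measurable_mean_residual P X XS XS_random X_sub X0)
      (measurable_iterate k).
    exact: measurable_fun_dotv.
  - by move=> w; rewrite ger0_norm ?dotv_ge0.
  - by apply: bounded_measurableZ; exact: bounded_measurable_phi.
have row i : \int[Q]_w (\sum_(j < N) dotv (r (x k w) (S k i w)) (r (x k w) (S k j w)))
    <= N%:R * (gamma * p) + (p - gamma * p).
  rewrite mean_sum => [|j]; last exact: bounded_measurable_pair.
  rewrite (bigD1 i) //= mean_pair_same -/p.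
  have -> : N%:R * (gamma * p) = \sum_(j < N) gamma * p.
    by rewrite sumr_const card_ord mulr_natl.
  rewrite [X in _ <= X + _](bigD1 i) //=.
  have : \sum_(j < N | j != i)
      \int[Q]_w dotv (r (x k w) (S k i w)) (r (x k w) (S k j w))
      <= \sum_(j < N | j != i) gamma * p.
    by apply: ler_sum => j ji; rewrite mean_pair_diff // eq_sym.
  lra.
have N0 : (N%:R : R) != 0 by rewrite pnatr_eq0 -lt0n.
apply: le_trans (_ : N%:R^-1 ^+ 2 * \sum_(i < N) (N%:R * (gamma * p) + (p - gamma * p)) <= _).
  by rewrite ler_wpM2l ?sqr_ge0 //; apply: ler_sum => i _; exact: row.
rewrite sumr_const card_ord -[X in _ * X <= _]mulr_natl.
by rewrite le_eqVlt; apply/orP; left; apply/eqP; rewrite /gammaN; field.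
Qed.

Lemma bounded_measurable_dist k : bounded_measurable (fun w => dist_set X (x k w) ^+ 2).
Proof.
split; first exact: (measurableT_comp (measurable_dist_set_sqr X X_closed X0) (measurable_iterate k)).
case: X0 => y Xy; have [M xM] := iterate_bounded y Xy k; exists M => w.
by rewrite ger0_norm ?sqr_ge0 // (le_trans (dist_set_sqr_le X X_closed X0 _ _ Xy)).
Qed.

Lemma mean_dist_step k :
  \int[Q]_w (dist_set X (x k.+1 w) ^+ 2)
    <= \int[Q]_w (dist_set X (x k w) ^+ 2)
       - alpha k * (2 - alpha k * gammaN) * \int[Q]_w phi (x k w).
Proof.
have bd := bounded_measurable_dist; have be := bounded_measurable_energy k.
have bn := bounded_measurable_noise k.
have b2e := bounded_measurableZ (2 * alpha k) _ be.
have b2n := bounded_measurableZ (alpha k ^+ 2) _ bn.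
have bde := bounded_measurableB _ _ (bd k) b2e.
have step w : dist_set X (x k.+1 w) ^+ 2
    <= dist_set X (x k w) ^+ 2 - 2 * alpha k * energy k w + alpha k ^+ 2 * noise k w.
  (* y varies with the run, but the inequality that remains mentions only [dist_set], whose
     measurability is established. *)
  set y := proj X (x k w); have Xy : X y by exact: proj_in.
  apply: le_trans (dist_set_sqr_le X X_closed X0 _ _ Xy) _.
  by rewrite dist_set_sqr // -/y x_step; exact: spa_step_sqdist.
apply: le_trans (le_mean Q _ _ (bd k.+1) _ step) _.
  exact: bounded_measurableD.
rewrite meanD // meanB // (meanZ Q (2 * alpha k)) // (meanZ Q (alpha k ^+ 2)) //.
rewrite mean_energy.
have := ler_wpM2l (sqr_ge0 (alpha k)) (mean_noise_le k).
move: (\int[Q]_w noise k w) (\int[Q]_w phi (x k w)) (\int[Q]_w _) => c p D; lra.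
Qed.

Let NV_gt0 : 0 < (N%:R : R)^-1. Proof. by rewrite invr_gt0 ltr0n. Qed.
Let NV_le1 : (N%:R : R)^-1 <= 1.
Proof. by rewrite invf_le1 ?ltr0n // ler1n. Qed.

Let gammaN_gt0 : 0 < gammaN.
Proof.
rewrite /gammaN; have := mulr_ge0 (_ : 0 <= 1 - N%:R^-1) gamma_ge0.
by rewrite subr_ge0 => /(_ NV_le1); have := NV_gt0; lra.
Qed.

Context (delta : R) (delta_gt0 : 0 < delta) (delta_le : delta <= 1 / gammaN).
Context (alpha_bnd : forall k, delta <= alpha k <= 2 / gammaN - delta).

Let alpha_gt0 k : 0 < alpha k.
Proof. by have /andP[le _] := alpha_bnd k; exact: lt_le_trans le. Qed.

Let mean_phi_ge0 k : 0 <= \int[Q]_w phi (x k w).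
Proof. by apply: mean_ge0 => w; exact: mean_sqdist_ge0. Qed.

Let bounded_sqdist k : bounded_measurable (fun w => dist_set X (x k w) ^+ 2).
Proof. exact: bounded_measurable_dist. Qed.

Lemma mean_dist_decrease k :
  \int[Q]_w (dist_set X (x k.+1 w) ^+ 2)
    + delta * gammaN * (alpha k * \int[Q]_w phi (x k w))
  <= \int[Q]_w (dist_set X (x k w) ^+ 2).
Proof.
have step := mean_dist_step k.
have /andP[_ le] := alpha_bnd k.
(* This turns the factor 2 - alpha gammaN of the mean descent into delta gammaN. *)
have le2 : alpha k * gammaN <= 2 - delta * gammaN.
  by have := ler_wpM2r (ltW gammaN_gt0) le; rewrite mulrBl divfK ?gt_eqF.
have := mulr_ge0 (ltW (alpha_gt0 k)) (mean_phi_ge0 k).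
move: step; set p := \int[Q]_w phi (x k w); set D := \int[Q]_w _.
set D' := \int[Q]_w _; move: p D D' => p D D' step ap.
have := ler_wpM2l ap le2; lra.
Qed.

Lemma mean_dist_init : \int[Q]_w (dist_set X (x 0%N w) ^+ 2) = dist_set X x0 ^+ 2.
Proof. by under eq_Rintegral do rewrite x_init; rewrite mean_cst. Qed.

Lemma sum_mean_phi_le k :
  delta * gammaN * \sum_(i < k) alpha i * \int[Q]_w phi (x i w) <= dist_set X x0 ^+ 2.
Proof.
rewrite -mean_dist_init.
apply: (descent_sum_le (fun k => \int[Q]_w (dist_set X (x k w) ^+ 2))
  (fun k => alpha k * \int[Q]_w phi (x k w)) _ _ mean_dist_decrease) => i.
by apply: mean_ge0 => w; exact: sqr_ge0.
Qed.

(** * The rate for the averaged iterates *)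

Section Average.
Context (xhat : nat -> T -> 'rV[R]_n) (xhat_def : forall k w,
  xhat k w = (\sum_(i < k) alpha i)^-1 *: \sum_(i < k) alpha i *: x i w).

Lemma measurable_average k : measurable_fun setT (xhat k : T -> E).
Proof.
rewrite (_ : xhat k = (fun w => (\sum_(i < k) alpha i)^-1 *: \sum_(i < k) alpha i *: x i w)).
  apply: measurable_fun_scalev; apply: measurable_fun_sumv => i.
  by apply: measurable_fun_scalev; exact: measurable_iterate.
by apply/funext => w; exact: xhat_def.
Qed.

Let phi_average_le k w : (\sum_(i < k.+1) alpha i) * phi (xhat k.+1 w)
  <= \sum_(i < k.+1) alpha i * phi (x i w).
Proof.
rewrite xhat_def; apply: (convex_weighted_avg phi alpha (fun i => x i w)) => // t u v.
exact: (mean_sqdist_convex P X).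
Qed.

Let sum_alpha_gt0 k : 0 < \sum_(i < k.+1) alpha i.
Proof. by rewrite big_ord_recr /= ltr_wpDl // sumr_ge0 // => i _; exact: ltW. Qed.

Let bounded_sum k : bounded_measurable (fun w => \sum_(i < k) alpha i * phi (x i w)).
Proof.
apply: bounded_measurable_sum => i; apply: bounded_measurableZ.
exact: bounded_measurable_phi.
Qed.

Lemma bounded_measurable_phi_average k :
  bounded_measurable (fun w => phi (xhat k.+1 w)).
Proof.
apply: (bounded_measurable_le _ (fun w => (\sum_(i < k.+1) alpha i)^-1 *
  \sum_(i < k.+1) alpha i * phi (x i w))).
- exact: (measurableT_comp (measurable_mean_sqdist P X XS XS_random X_sub X0)
    (measurable_average k.+1)).
- move=> w; rewrite ger0_norm ?mean_sqdist_ge0 //.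
  by rewrite ler_pdivlMl //; exact: phi_average_le.
- exact: bounded_measurableZ.
Qed.

Lemma mean_phi_average_le k :
  \int[Q]_w phi (xhat k.+1 w)
  <= dist_set X x0 ^+ 2 / (delta * gammaN * \sum_(i < k.+1) alpha i).
Proof.
have bphi := bounded_measurable_phi.
have dg := mulr_gt0 delta_gt0 gammaN_gt0.
rewrite ler_pdivlMr; last exact: mulr_gt0.
rewrite mulrC -[X in X <= _]mulrA.
apply: le_trans (sum_mean_phi_le k.+1).
apply: ler_wpM2l; first exact: ltW.
rewrite -meanZ; last exact: bounded_measurable_phi_average.
under [X in _ <= X]eq_bigr do rewrite -meanZ //.
rewrite -mean_sum => [|i]; last exact: bounded_measurableZ.
apply: le_mean => [| |w]; last exact: phi_average_le.
- by apply: bounded_measurableZ; exact: bounded_measurable_phi_average.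
- exact: bounded_sum.
Qed.

End Average.

(** * Geometric decay under linear regularity *)

Section LinearRegularity.
Context (kappa : R) (kappa_gt0 : 0 < kappa) (regular : linear_regularity P XS X kappa).

Let regular_phi z : dist_set X z ^+ 2 <= kappa * phi z.
Proof.
by have := regular z; rewrite (expectation_dist P X) // -EFinM lee_fin.
Qed.

Let phi_le_dist z : phi z <= gamma * dist_set X z ^+ 2.
Proof.
rewrite dist_set_sqr //; apply: (mean_sqdist_le_gamma P X) => //.
exact: proj_in.
Qed.

Let rate := 1 - delta ^+ 2 * gammaN / kappa.

(** In the decrease delta gammaN alpha E phi, the lower bound on alpha gives the second delta and
    regularity replaces E phi by E dist^2 / kappa. *)
Lemma mean_dist_contract k :
  \int[Q]_w (dist_set X (x k.+1 w) ^+ 2)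
  <= rate * \int[Q]_w (dist_set X (x k w) ^+ 2).
Proof.
have bphi := bounded_measurable_phi k.
have reg : \int[Q]_w (dist_set X (x k w) ^+ 2) <= kappa * \int[Q]_w phi (x k w).
  by rewrite -meanZ //; apply: le_mean => //; exact: bounded_measurableZ.
have := mean_dist_decrease k; have p0 := mean_phi_ge0 k.
have /andP[le _] := alpha_bnd k.
have := ler_wpM2r p0 le.
move: reg p0; set p := \int[Q]_w phi (x k w).
set D := \int[Q]_w (dist_set X (x k w) ^+ 2) => reg p0 ap dec.
have dg := mulr_gt0 delta_gt0 gammaN_gt0.
have h1 := ler_wpM2l (ltW dg) ap.
have h2 : delta ^+ 2 * gammaN / kappa * D <= delta * gammaN * (delta * p).
  rewrite mulrAC ler_pdivrMr //.
  have := ler_wpM2l (ltW (mulr_gt0 delta_gt0 dg)) reg; lra.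
rewrite /rate mulrBl mul1r; lra.
Qed.

(* When every distance to X vanishes the rate may be negative. *)
Lemma rate_ge0_or : 0 <= rate \/ forall z, dist_set X z ^+ 2 = 0.
Proof.
have [all0|/existsNP[z zX]] := pselect (forall z, dist_set X z ^+ 2 = 0); first by right.
left; have {zX} D0 : 0 < dist_set X z ^+ 2 by rewrite lt_neqAle eq_sym (introN eqP) ?sqr_ge0.
have NV1 := NV_le1; have NV0 := NV_gt0.
(* At z off X, dist^2 <= kappa phi <= kappa gamma dist^2 gives kappa gamma >= 1, and gamma <= gammaN
   if gamma <= 1. If gamma > 1, then phi <= dist^2 gives kappa >= 1, and gammaN >= 1. *)
have kg : 1 <= kappa * gammaN.
  have reg := regular_phi z.
  have [g1|g1] := leP gamma 1.
    have : 1 <= kappa * gamma.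
      rewrite -(ler_pM2r D0) mul1r -mulrA; apply: le_trans reg _.
      by rewrite ler_wpM2l ?(ltW kappa_gt0).
    have : gamma <= gammaN by rewrite /gammaN; nra.
    by move=> /(ler_wpM2l (ltW kappa_gt0)); lra.
  have : 1 <= kappa.
    rewrite -(ler_pM2r D0) mul1r; apply: le_trans reg _.
    rewrite ler_wpM2l ?(ltW kappa_gt0) // dist_set_sqr //.
    by apply: (mean_sqdist_le P X) => //; exact: proj_in.
  have : 1 <= gammaN by rewrite /gammaN; nra.
  by move=> g2 k1; nra.
have dg1 : delta * gammaN <= 1 by rewrite -ler_pdivlMr.
have dg0 := mulr_gt0 delta_gt0 gammaN_gt0.
(* After multiplication by gammaN the claim reads (delta gammaN)^2 <= kappa gammaN, and 1 separates
   the two sides. *)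
rewrite /rate subr_ge0 ler_pdivrMr // mul1r -(ler_pM2r gammaN_gt0).
apply: le_trans kg; rewrite -mulrA (_ : _ * _ = (delta * gammaN) ^+ 2); last by ring.
by rewrite expr_le1 // ltW.
Qed.

(** Iterating the contraction multiplies inequalities by the rate, hence needs its sign; in the
    degenerate case both sides are 0. *)
Lemma mean_dist_geometric k :
  \int[Q]_w (dist_set X (x k w) ^+ 2) <= rate ^+ k * dist_set X x0 ^+ 2.
Proof.
have [r0|all0] := rate_ge0_or.
  elim: k => [|k IHk]; first by rewrite expr0 mul1r mean_dist_init.
  apply: le_trans (mean_dist_contract k) _.
  by rewrite exprS -mulrA ler_wpM2l.
by under eq_Rintegral do rewrite all0; rewrite mean_cst all0 mulr0.
Qed.

Lemma mean_phi_geometric k :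
  \int[Q]_w phi (x k w) <= rate ^+ k * (gamma * dist_set X x0 ^+ 2).
Proof.
rewrite mulrCA; apply: le_trans (ler_wpM2l gamma_ge0 (mean_dist_geometric k)).
rewrite -meanZ //; apply: le_mean => //; first exact: bounded_measurable_phi.
exact: bounded_measurableZ.
Qed.

End LinearRegularity.

(** * Almost sure convergence of the iterates *)

Section AlmostSure.

(** The energy bounds the quasi-Fejer error and phi identifies the cluster points; summing them
    together gives one exceptional null set for both. *)
Let increment k w := energy k w + phi (x k w).

Let bounded_increment k : bounded_measurable (increment k).
Proof.
by apply: bounded_measurableD; [exact: bounded_measurable_energy|exact: bounded_measurable_phi].
Qed.

Let increment_ge0 k w : 0 <= increment k w.
Proof. by rewrite addr_ge0 ?batch_energy_ge0 ?mean_sqdist_ge0. Qed.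

(** By monotone convergence the series has a finite integral, so it is finite almost everywhere. *)
Lemma increment_summable :
  {ae Q, forall w, exists C, forall K, \sum_(i < K) increment i w <= C}.
Proof.
pose f w := (\sum_(0 <= k <oo) (increment k w)%:E)%E.
have m k : measurable_fun setT (fun w => (increment k w)%:E).
  by apply/measurable_EFinP; case: (bounded_increment k).
have f0 k w : (0 <= (increment k w)%:E)%E by rewrite lee_fin.
have D0 := sqr_ge0 (dist_set X x0).
have dg := mulr_gt0 delta_gt0 gammaN_gt0.
have intf : Q.-integrable setT f.
  apply/integrableP; split; first exact: ge0_emeasurable_sum.
  under eq_integral do rewrite gee0_abs ?nneseries_ge0 //.
  rewrite integral_nneseries //.
  under eq_eseriesr do rewrite -EFin_Rintegral //.
  (* The 2 counts energy and phi, which have equal means; the last division by delta removes the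
     weights alpha. *)
  apply: (@le_lt_trans _ _ (2 * (dist_set X x0 ^+ 2 / (delta * gammaN) / delta))%:E); last exact: ltry.
  apply: lime_le; first by apply: is_cvg_nneseries => k _ _; rewrite lee_fin mean_ge0.
  near=> K; rewrite sumEFin lee_fin big_mkord.
  have -> : \sum_(i < K) \int[Q]_w increment i w = 2 * \sum_(i < K) \int[Q]_w phi (x i w).
    rewrite mulr_sumr; apply: eq_bigr => i _; rewrite meanD.
    - by rewrite mean_energy mulr_natl mulr2n.
    - exact: bounded_measurable_energy.
    - exact: bounded_measurable_phi.
  rewrite ler_wpM2l // !ler_pdivlMr // mulrC.
  apply: le_trans (sum_mean_phi_le K).
  rewrite ler_wpM2l ?(ltW dg) // mulr_suml; apply: ler_sum => i _.
  by rewrite mulrC ler_wpM2r //; have /andP[] := alpha_bnd i.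
have := integrable_ae measurableT intf; apply: filterS => w /(_ I) fw.
exists (fine (f w)) => K; rewrite -lee_fin fineK // -sumEFin.
rewrite -(big_mkord xpredT (fun k => (increment k w)%:E)).
exact: nneseries_lim_ge.
Unshelve. all: by end_near.
Qed.

Lemma spa_cvg_ae : exactness P XS X ->
  {ae Q, forall w, exists2 p, X p &
    forall e : R, 0 < e -> \forall k \near \oo, dotv (x k w - p) (x k w - p) < e}.
Proof.
move=> exact_X; have := increment_summable; apply: filterS => w [C wC].
(* The stepsizes are at most 2 / gammaN, which bounds the factor alpha^2 of the energy uniformly in
   k. *)
apply: (quasi_fejer_cvg X (fun k => x k w) (fun k => increment k w) ((2 / gammaN) ^+ 2) C) => //.
- exact: sqr_ge0.
- move=> y k Xy; apply: le_trans (iterate_step_le k w y Xy) _; rewrite lerD2l.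
  apply: ler_pM; rewrite ?sqr_ge0 ?batch_energy_ge0 //.
    have /andP[_ le] := alpha_bnd k.
    by rewrite ler_pXn2r ?nnegrE ?alpha_ge0 ?divr_ge0 ?(ltW gammaN_gt0) // (le_trans le) // gerBl ltW.
  by rewrite lerDl mean_sqdist_ge0.
- move=> p pcl; apply: (exactness_mem P X XS) => //.
  apply/eqP; rewrite eq_le mean_sqdist_ge0 andbT; apply/ler_addgt0Pl => e e0.
  (* [mean_sqdist_perturb] doubles both phi(x_k) and |x_k - p|^2, so each may take a quarter of e.
     The increment at k is the sum's growth from k to k + 1. *)
  have e4 : 0 < e / 4 by rewrite divr_gt0.
  have [K tail] := summable_tail _ _ (fun k => increment_ge0 k w) wC _ e4.
  have [k Kk xk] := pcl (e / 4) K e4.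
  have := tail k k.+1 Kk (leqnSn k); rewrite big_ord_recr /= addrAC subrr add0r => lt.
  have phile : phi (x k w) <= increment k w by rewrite lerDr batch_energy_ge0.
  have := mean_sqdist_perturb P X XS XS_random X_sub X0 p (x k w).
  have -> : dotv (p - x k w) (p - x k w) = dotv (x k w - p) (x k w - p).
    by rewrite -opprB dotvNl dotvNr opprK.
  move=> le; rewrite addr0; apply: (le_trans le).
  move: phile lt xk {le}.
  move: (phi (x k w)) (increment k w) (dotv _ _) => a b c {wC tail pcl}; lra.
Qed.

End AlmostSure.

End StochasticProcess.

(** * Translation to the extended-real expectations of the statement *)

Section ExtendedRealForms.
Context {R : realType} {n : nat} {d : measure_display} {Om : measurableType d}.
Context (P : probability Om R) (X : set 'rV[R]_n) (XS : Om -> set 'rV[R]_n).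
Context (XS_random : random_closed_convex_set XS).
Context (X_sub : forall s, X `<=` XS s) (X0 : X !=set0).
Context {d' : measure_display} {T : measurableType d'} (Q : probability T R).
Context (z : T -> 'rV[R]_n).
Context (phi_z : bounded_measurable (fun w => mean_sqdist P XS (z w))).

Lemma integral_objective_gap :
  (\int[Q]_w objective P XS (z w) - objective_min P XS
   = (2^-1 * \int[Q]_w mean_sqdist P XS (z w))%:E)%E.
Proof.
rewrite (objective_minE P X) // sube0.
under eq_integral do rewrite (objectiveE P X) //.
by rewrite -EFin_Rintegral ?meanZ //; exact: bounded_measurableZ.
Qed.

Lemma integral_prod_dist : measurable_fun setT (z : T -> borel_rV R n) ->
  (\int[Q \x P]_p ((dist_set (XS p.2) (z p.1)) ^+ 2)%:E
   = (\int[Q]_w mean_sqdist P XS (z w))%:E)%E.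
Proof.
move=> mz; have XS_closed s : closed (XS s) by case: XS_random.
have XS0 s : XS s !=set0 by case: X0 => y Xy; exists y; exact: X_sub.
under eq_integral do rewrite (dist_residual X) //.
rewrite fubini_tonelli1.
- rewrite EFin_Rintegral //; apply: eq_integral => w _.
  rewrite /fubini_F /mean_sqdist EFin_Rintegral //.
  exact: (bounded_measurable_residual_sqr X).
- apply/measurable_EFinP.
  have m := measurable_residual XS XS_random (fun p : T * Om => z p.1) (fun p : T * Om => p.2)
    (measurableT_comp mz measurable_fst) measurable_snd.
  exact: measurable_fun_dotv.
- by move=> p; rewrite lee_fin dotv_ge0.
Qed.

End ExtendedRealForms.

Lemma expectation_Rintegral {R : realType} {d} {T : measurableType d}
    (Q : probability T R) (f : T -> R) :
  bounded_measurable f -> ('E_Q[f] = (\int[Q]_w f w)%:E)%E.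
Proof. by move=> bf; rewrite unlock EFin_Rintegral. Qed.

(** Limits are found run by run and must be assembled into a random variable. Coordinatewise upper
    limits are measurable on the whole space and agree with the limit wherever there is one. *)
Lemma measurable_limit_rV {R : realType} {n : nat} {d} {T : measurableType d}
    (Q : probability T R) (z : nat -> T -> 'rV[R]_n) :
  (forall k, measurable_fun setT (z k : T -> borel_rV R n)) ->
  exists zlim : {RV Q >-> borel_rV R n},
    forall w p, z ^~ w @ \oo --> p -> zlim w = p.
Proof.
move=> mz.
(* [fine] sends an infinite upper limit to 0, which can occur only where the sequence diverges. *)
pose f w : borel_rV R n := \row_j fine (limn_esup (fun k => (z k w 0 j)%:E)).
have mf : measurable_fun setT f.
  apply: measurable_fun_rV => j.
  rewrite (_ : (fun w => _) = fine \o (fun w => limn_esup (fun k => (z k w 0 j)%:E))); last first.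
    by apply/funext => w; rewrite mxE.
  apply: (measurableT_comp (@fine_measurable R setT measurableT)).
  apply: measurable_fun_limn_esup => k.
  by apply/measurable_EFinP; exact: measurable_fun_coord.
exists (HB.pack f (isMeasurableFun.Build _ _ _ _ _ mf) : {RV Q >-> borel_rV R n}).
move=> w p zp; apply/rowP => j; rewrite /= mxE.
have zj : (z k w 0 j)%:E @[k --> \oo] --> (p 0 j)%:E.
  apply: cvg_EFin; first by near=> k.
  exact: (@cvg_comp _ _ _ (z ^~ w) (fun M : 'rV_n => M 0 j) _ _ _ zp
    (@coord_continuous _ _ _ 0 j p)).
rewrite is_cvg_limn_esupE; last by apply/cvg_ex; exists (p 0 j)%:E.
by rewrite (cvg_lim _ zj).
Unshelve. all: by end_near.
Qed.
Theorem theorem9 (R : realType) (n : nat)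
  (d : measure_display) (Om : measurableType d) (P : probability Om R)
  (X : set 'rV[R]_n) (XS : Om -> set 'rV[R]_n)
  (X_closed : closed X)
  (X_convex : convex_set (X : set (convex_lmodType 'rV[R]_n)))
  (XS_random : random_closed_convex_set XS)
  (X_sub : forall s, X `<=` XS s)
  (X_nonempty : X !=set0)
  (gamma : R) (gammaP : is_gamma P XS gamma)
  (N : nat) (N_gt0 : (0 < N)%N)
  (gammaN : R) (gammaN_def : gammaN = N%:R^-1 + (1 - N%:R^-1) * gamma)
  (* the probability space carrying the run of the algorithm *)
  (d' : measure_display) (T : measurableType d') (Q : probability T R)
  (S : nat -> 'I_N -> {RV Q >-> Om}) (S_iid : iid_samples P S)
  (x0 : 'rV[R]_n) (alpha : nat -> R) (alpha_gt0 : forall k, 0 < alpha k)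
  (delta : R) (delta_gt0 : 0 < delta) (delta_le : delta <= 1 / gammaN)
  (alpha_bnd : forall k, delta <= alpha k <= 2 / gammaN - delta)
  (x : nat -> T -> 'rV[R]_n) (x_init : forall w, x 0%N w = x0)
  (x_step : forall k w,
     x k.+1 w = spa_step XS (alpha k) (fun i => S k i w) (x k w))
  (Sigma : nat -> R) (Sigma_def : forall k, Sigma k = \sum_(i < k) alpha i)
  (xhat : nat -> T -> 'rV[R]_n)
  (xhat_def : forall k w,
     xhat k w = (Sigma k)^-1 *: \sum_(i < k) alpha i *: x i w) :
  [/\ (forall k, (0 < k)%N ->
         (\int[Q]_w objective P XS (xhat k w) - objective_min P XS
          = (2^-1)%:E * \int[Q \x P]_p ((dist_set (XS p.2) (xhat k p.1)) ^+ 2)%:E)%E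
         /\
         ((2^-1)%:E * \int[Q \x P]_p ((dist_set (XS p.2) (xhat k p.1)) ^+ 2)%:E
          <= (dist_set X x0 ^+ 2 / (2 * delta * gammaN * Sigma k))%:E)%E),
      (exactness P XS X ->
         exists xbar : {RV Q >-> borel_rV R n},
           {ae Q, forall w, X (xbar w) /\
                            xhat ^~ w @ \oo --> (xbar w : 'rV[R]_n)})
    & (forall kappa : R, 0 < kappa -> linear_regularity P XS X kappa ->
         forall k,
           ('E_Q[fun w => (dist_set X (x k.+1 w) ^+ 2)%R]
            <= (1 - delta ^+ 2 * gammaN / kappa)%:E
               * 'E_Q[fun w => (dist_set X (x k w) ^+ 2)%R])%E
           /\
           (\int[Q]_w objective P XS (x k w) - objective_min P XS
            <= ((1 - delta ^+ 2 * gammaN / kappa) ^+ k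
                * (gamma * dist_set X x0 ^+ 2 / 2))%:E)%E)].
Proof.
case: gammaP => gamma_ge0 gamma_bnd _; subst gammaN.
have alpha_ge0 k : 0 <= alpha k by rewrite ltW.
have m_phi k : bounded_measurable (fun w => mean_sqdist P XS (x k w)).
  exact: (bounded_measurable_phi P X XS XS_random X_sub X_nonempty N N_gt0 Q S S_iid x0 alpha alpha_ge0
    x x_init x_step k).
have m_dist k : bounded_measurable (fun w => dist_set X (x k w) ^+ 2).
  exact: (bounded_measurable_dist P X XS X_closed XS_random X_sub X_nonempty N N_gt0 Q S S_iid x0
    alpha alpha_ge0 x x_init x_step k).
have xhat_def' k w :
    xhat k w = (\sum_(i < k) alpha i)^-1 *: \sum_(i < k) alpha i *: x i w.
  by rewrite xhat_def Sigma_def.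
have m_xhat k : measurable_fun setT (xhat k : T -> borel_rV R n).
  exact: (measurable_average P XS XS_random N Q S S_iid x0 alpha x).
split.
- case=> [//|k _].
  have m_phihat : bounded_measurable (fun w => mean_sqdist P XS (xhat k.+1 w)).
    exact: (bounded_measurable_phi_average P X XS XS_random X_sub X_nonempty gamma N
      N_gt0 Q S S_iid x0 alpha alpha_ge0 x x_init x_step delta).
  rewrite (integral_objective_gap P X) // (integral_prod_dist P X) //.
  split; first by rewrite EFinM.
  rewrite -EFinM lee_fin Sigma_def -[2 * delta * _]mulrA -[2 * _ * _]mulrA invfM mulrCA.
  rewrite ler_wpM2l ?invr_ge0 //.
  exact: (mean_phi_average_le P X XS X_closed XS_random X_sub X_nonempty gamma
    gamma_ge0 gamma_bnd N N_gt0 Q S S_iid).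
- move=> exact_X.
  (* xbar is fixed on all runs before the null set is discarded. *)
  have [xbar xbarP] := measurable_limit_rV Q xhat m_xhat.
  exists xbar.
  have := spa_cvg_ae P X XS X_closed XS_random X_sub X_nonempty gamma gamma_ge0
    gamma_bnd N N_gt0 Q S S_iid x0 alpha alpha_ge0 x x_init x_step delta delta_gt0
    alpha_bnd exact_X.
  apply: filterS => w [p Xp xp].
  have xhatp : xhat ^~ w @ \oo --> p.
    apply: cvg_rV_dotv => e e0.
    have a_ge i : delta <= alpha i by have /andP[] := alpha_bnd i.
    have := weighted_cesaro alpha (fun k => x k w) p delta delta_gt0 a_ge xp e e0.
    by apply: filterS => k; rewrite xhat_def'.
  by rewrite (xbarP w p xhatp).
- move=> kappa kappa_gt0 regular k; split.
    rewrite !expectation_Rintegral // -EFinM lee_fin.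
    exact: (mean_dist_contract P X XS X_closed XS_random X_sub X_nonempty gamma
      gamma_ge0 gamma_bnd N N_gt0 Q S S_iid x0 alpha alpha_ge0 x x_init x_step).
  rewrite (integral_objective_gap P X) // lee_fin mulrC mulrA ler_wpM2r ?invr_ge0 //.
  exact: (mean_phi_geometric P X XS X_closed XS_random X_sub X_nonempty gamma
    gamma_ge0 gamma_bnd N N_gt0 Q S S_iid x0 alpha alpha_ge0 x x_init x_step).
Qed.
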